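(* Let $A\in\mathfrak{H}_n$ and $B\in\mathfrak{M}_n$. Let $\lambda_{\min}$ and $\lambda_{\max}$ be the smallest and the largest eigenvalues of $A$, and let $\mathfrak{B}$ be the $\sigma$-algebra of Borel subsets of the closed interval $[\lambda_{\min},\lambda_{\max}]$. Then there exists a set function $M:\mathfrak{B}\to\mathfrak{M}_n$ such that: (1) $M$ is countably additive and regular on $\mathfrak{B}$, i.e. $M$ is a regular Borel $\mathfrak{M}_n$-valued measure on $[\lambda_{\min},\lambda_{\max}]$; (2) for every $t\in\mathbb{C}$, \[ e^{tA+B}=\int_{[\lambda_{\min},\lambda_{\max}]} e^{t\lambda}\,M(d\lambda); \] (3) if moreover $B\in\mathfrak{H}_n$, then $M$ is $\mathfrak{H}_n$-valued, i.e. $M(\delta)\in\mathfrak{H}_n$ for every $\delta\in\mathfrak{B}$.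
   Context: $\mathfrak{M}_n$ denotes the set of complex $n\times n$ matrices, $\mathfrak{H}_n$ the set of Hermitian $n\times n$ matrices. For a matrix-valued measure the integral is taken entrywise. *)

(* Defs.v *)
From HB Require Import structures.
From mathcomp Require Import all_boot all_order all_algebra.
From mathcomp Require Import all_classical all_reals all_analysis.
From mathcomp.real_closed Require Import complex.
Set Implicit Arguments.
Unset Strict Implicit.
Unset Printing Implicit Defensive.
Import Order.TTheory GRing.Theory Num.Theory.
Import numFieldNormedType.Exports.
Local Open Scope classical_set_scope.
Local Open Scope ring_scope.
Local Open Scope complex_scope.

Section Defs.
Variable R : realType.
Local Notation C := R[i].

Definition hermitian_mx n (A : 'M[C]_n) : Prop :=
  forall i j, A j i = conjc (A i j).

(* lmin is the smallest eigenvalue of A (order of the numClosedField R[i]: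
   x <= y iff Im x = Im y and Re x <= Re y). *)
Definition is_min_eigenvalue n (A : 'M[C]_n) (lmin : R) : Prop :=
  eigenvalue A (lmin%:C)%C /\ forall a, eigenvalue A a -> (lmin%:C)%C <= a.

Definition is_max_eigenvalue n (A : 'M[C]_n) (lmax : R) : Prop :=
  eigenvalue A (lmax%:C)%C /\ forall a, eigenvalue A a -> a <= (lmax%:C)%C.

Definition cexp (z : C) : C :=
  (expR (complex.Re z) * cos (complex.Im z)) +i* (expR (complex.Re z) * sin (complex.Im z)).

Definition expm_partial n (X : 'M[C]_n) (N : nat) : 'M[C]_n :=
  \sum_(k < N) (k`!%:R)^-1 *: X ^+ k.

Definition expm n (X : 'M[C]_n) : 'M[C]_n :=
  \matrix_(i, j) ((limn (fun N => complex.Re (expm_partial X N i j)))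
                  +i* (limn (fun N => complex.Im (expm_partial X N i j))))%C.

Definition borel_in (a b : R) (D : set R) : Prop :=
  measurable D /\ D `<=` `[a, b].

Definition mx_countably_additive n (a b : R) (M : set R -> 'M[C]_n) : Prop :=
  forall F : nat -> set R, (forall k, borel_in a b (F k)) ->
    trivIset setT F ->
    forall i j,
      ((fun N => \sum_(k < N) complex.Re (M (F k) i j)) @ \oo -->
         complex.Re (M (\bigcup_k F k) i j)) /\
      ((fun N => \sum_(k < N) complex.Im (M (F k) i j)) @ \oo -->
         complex.Im (M (\bigcup_k F k) i j)).

(* regularity (Dunford-Schwartz III.5.11): for every Borel D and e > 0
   there are a closed F and an open U (relative to [a,b]) with
   F <= D <= U and |M(S)| < e for every Borel S <= U \ F. *)
Definition mx_regular n (a b : R) (M : set R -> 'M[C]_n) : Prop :=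
  forall D, borel_in a b D -> forall e : R, 0 < e ->
    exists F U : set R, [/\ closed F, open U, F `<=` D, D `<=` U &
      forall S, borel_in a b S -> S `<=` U `\` F ->
        forall i j, `|complex.Re (M S i j)| < e /\ `|complex.Im (M S i j)| < e].

Definition pos_var (a b : R) (nu : set R -> R) (E : set R) : \bar R :=
  ereal_sup [set (nu S)%:E | S in [set S | borel_in a b S /\ S `<=` E]].

Definition neg_var (a b : R) (nu : set R -> R) (E : set R) : \bar R :=
  ereal_sup [set (- nu S)%:E | S in [set S | borel_in a b S /\ S `<=` E]].

Definition rintegral (a b : R) (nu : set R -> R) (f : R -> R) : R :=
  fine (\int[pos_var a b nu]_(x in `[a, b]) (f x)%:E)%E
  - fine (\int[neg_var a b nu]_(x in `[a, b]) (f x)%:E)%E.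

Definition cintegral (a b : R) (mu : set R -> C) (f : R -> C) : C :=
  ((rintegral a b (fun S => complex.Re (mu S)) (fun x => complex.Re (f x))
    - rintegral a b (fun S => complex.Im (mu S)) (fun x => complex.Im (f x)))
   +i* (rintegral a b (fun S => complex.Re (mu S)) (fun x => complex.Im (f x))
    + rintegral a b (fun S => complex.Im (mu S)) (fun x => complex.Re (f x))))%C.

Definition mx_integral n (a b : R) (M : set R -> 'M[C]_n) (f : R -> C)
  : 'M[C]_n :=
  \matrix_(i, j) cintegral a b (fun S => M S i j) f.

End Defs.

(* Main.v *)
(* Expanding exp(tA + B) in powers of B gives the sum over k, m of t^m / (m + k)!
   times the sum [word A B k m] of all words with k letters B and m letters A.
   After diagonalizing A = diag(d_1, ..., d_n), for fixed k the entries of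
   m! / (m + k)! * word A B k m are complex combinations, over index paths
   i_0, ..., i_k, of the m-th moments of the distribution of sum_j s_j d_(i_j),
   with s uniform on the standard simplex, divided by k!.  These distributions
   live on [lmin, lmax], and appending an eigenvalue c to a path replaces the law
   of x by that of c + w (x - c), with w of density proportional to w^k; the total
   masses are O(s^k / k!), so the measures can be summed over k, and the moments
   identify the integral of exp(t lambda) with exp(tA + B). *)

Require Import Defs.
From HB Require Import structures.
From mathcomp Require Import all_boot all_order all_algebra.
From mathcomp Require Import all_classical all_reals all_analysis measurable_realfun.
From mathcomp.real_closed Require Import complex.
From mathcomp Require Import ring lra.
Import Order.TTheory GRing.Theory Num.Theory.
Local Open Scope classical_set_scope.
Local Open Scope ring_scope.
Set Implicit Arguments.
Unset Strict Implicit.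
Unset Printing Implicit Defensive.
Import numFieldNormedType.Exports.

(** * Bounded functions, clipping and images of finite measures *)

Section Moments.
Context {R : realType}.
Implicit Types (a b c x : R) (k m : nat).
Local Notation fmeas := {finite_measure set R -> \bar R}.

(** The integral in the theorem is taken against variations, suprema over Borel subsets that cannot
    be followed through sums and products. So every set function is carried as a difference of two
    finite positive measures, together with a bound on their total mass; such pairs are easily
    scaled, added, pushed forward and summed. Only afterwards does a Hahn decomposition show that
    any such pair computes the integral of the theorem.

    Neither simplices nor index paths are ever formed. Because A is diagonal, the last-letter
    recursion of an entry of [word] is, up to a factorial weight, the recursion satisfied by moments
    when one eigenvalue is appended; this one-dimensional step, with a beta density, is repeated
    entrywise, and the sum over paths is absorbed in matrix products.

    The measure must not depend on t. The exponential therefore enters late, and only through a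
    Taylor remainder bound of the form E t^N / N!, the very decay that combines with masses O(s^k /
    k!) by the binomial formula. *)

Lemma finite_measure_of (mu : {measure set R -> \bar R}) :
  (mu setT < +oo)%E -> exists nu : fmeas, (nu : set R -> \bar R) = mu.
Proof.
move=> muT.
(* Restriction to the whole space changes no value and carries the finite-measure structure. *)
exists (mfrestr measurableT muT); apply/funext => A.
by rewrite /= /mfrestr /mrestr setIT.
Qed.

Lemma fin_num_measureT d (T : measurableType d)
    (mu : {finite_measure set T -> \bar R}) : (mu setT < +oo)%E.
Proof. by rewrite ltey_eq fin_num_measure. Qed.

Definition bounded_mfun d (T : measurableType d) (f : T -> R) : Prop :=
  measurable_fun setT f /\ exists K : R, forall t, `|f t| <= K.

Lemma bounded_mfun_integrable d (T : measurableType d)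
    (mu : {measure set T -> \bar R}) (f : T -> R) :
  (mu setT < +oo)%E -> bounded_mfun f -> mu.-integrable setT (EFin \o f).
Proof.
move=> muT [mf [K fK]]; apply: measurable_bounded_integrable => //.
exists K; split; first exact: num_real.
by move=> M KM x _; apply: le_trans (fK x) (ltW KM).
Qed.

Lemma bounded_mfunD d (T : measurableType d) (f g : T -> R) :
  bounded_mfun f -> bounded_mfun g -> bounded_mfun (f \+ g).
Proof.
move=> [mf [K fK]] [mg [L gL]]; split; first exact: measurable_funD.
by exists (K + L) => x; apply: le_trans (ler_normD _ _) (lerD (fK x) (gL x)).
Qed.

Lemma bounded_mfunM d (T : measurableType d) (f g : T -> R) :
  bounded_mfun f -> bounded_mfun g -> bounded_mfun (f \* g).
Proof.
move=> [mf [K fK]] [mg [L gL]]; split; first exact: measurable_funM.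
by exists (K * L) => x; rewrite normrM ler_pM.
Qed.

Lemma bounded_mfun_cst d (T : measurableType d) (r : R) :
  bounded_mfun (fun _ : T => r).
Proof. by split; [exact: measurable_cst|exists `|r| => t]. Qed.

Lemma bounded_mfunX d (T : measurableType d) (f : T -> R) n :
  bounded_mfun f -> bounded_mfun (fun t => f t ^+ n).
Proof.
move=> bf; elim: n => [|n IH]; first exact: bounded_mfun_cst.
rewrite (_ : (fun _ => _) = f \* (fun t => f t ^+ n)); first exact: bounded_mfunM.
by apply/funext => t; rewrite exprS.
Qed.

(** For [a <= b], the retraction of the line onto [[a, b]]: it turns polynomials into bounded
    functions on the whole line. *)
Definition clip a b x : R := Num.max a (Num.min x b).

Lemma clip_itv a b x : a <= b -> a <= clip a b x <= b.
Proof. by move=> ab; rewrite /clip le_max lexx /= ge_max ab ge_min lexx orbT. Qed.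

Lemma clip_id a b x : a <= x <= b -> clip a b x = x.
Proof. by move=> /andP[ax xb]; rewrite /clip (min_idPl xb) (max_idPr ax). Qed.

Lemma measurable_clip a b : measurable_fun setT (clip a b).
Proof.
by apply: measurable_maxr => //; apply: measurable_minr.
Qed.

Lemma norm_itv_le a b x : a <= x <= b -> `|x| <= `|a| + `|b|.
Proof.
move=> /andP[ax xb]; have := ler_norm b; have := ler_norm (- a); rewrite normrN.
by rewrite ler_norml; have := normr_ge0 a; have := normr_ge0 b; lra.
Qed.

Lemma bounded_mfun_clip d (T : measurableType d) a b (f : T -> R) :
  a <= b -> measurable_fun setT f -> bounded_mfun (clip a b \o f).
Proof.
move=> ab mf; split; first by apply: measurableT_comp => //; exact: measurable_clip.
by exists (`|a| + `|b|) => t /=; exact/norm_itv_le/clip_itv.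
Qed.

Lemma bounded_pow_clip a b m : a <= b -> bounded_mfun (fun x : R => clip a b x ^+ m).
Proof.
by move=> ab; apply: bounded_mfunX; exact: (@bounded_mfun_clip _ R a b (fun t => t)).
Qed.

Lemma Rintegral_mscale (r : {nonneg R}) (nu : fmeas) (f : R -> R) :
  bounded_mfun f ->
  (\int[mscale r nu]_x f x)%R = r%:num * (\int[nu]_x f x)%R.
Proof.
move=> bf; rewrite /Rintegral.
have fi := bounded_mfun_integrable (fin_num_measureT nu) bf.
have mf : measurable_fun setT (EFin \o f) by case/integrableP: fi.
rewrite integralE !ge0_integral_mscale //=; [|exact: measurable_funeneg|exact: measurable_funepos].
rewrite -muleBr //; last exact: integrable_add_def.
by rewrite -integralE fineM //; exact: integrable_fin_num.
Qed.

Definition mass (mu : fmeas) : R := fine (mu setT).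

(* Clipping makes all moments finite, whatever the support of [mu]. *)
Definition moment a b (mu : fmeas) m : R :=
  (\int[mu]_x (clip a b x ^+ m))%R.

Lemma finite_pushforward d (T : measurableType d)
    (mu : {measure set T -> \bar R}) (phi : T -> R) :
  (mu setT < +oo)%E -> measurable_fun setT phi ->
  exists nu : fmeas, (nu : set R -> \bar R) = pushforward mu phi.
Proof.
move=> muT mphi; apply: (@finite_measure_of (pushforward mu phi)).
by rewrite /= /pushforward preimage_setT.
Qed.

Lemma Rintegral_pushforward d (T : measurableType d)
    (mu : {measure set T -> \bar R}) (phi : T -> R) (nu : fmeas) f :
  (mu setT < +oo)%E ->
  measurable_fun setT phi -> (nu : set R -> \bar R) = pushforward mu phi ->
  bounded_mfun f ->
  (\int[nu]_x f x)%R = (\int[mu]_x f (phi x))%R.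
Proof.
move=> muT mphi nuE bf; rewrite /Rintegral.
have -> : (\int[nu]_x (f x)%:E)%E = (\int[pushforward mu phi]_x (f x)%:E)%E.
  by rewrite -nuE.
rewrite integral_pushforward ?preimage_setT //.
- by apply/measurable_EFinP; case: bf.
- apply: (@bounded_mfun_integrable _ _ mu (f \o phi)).
    by [].
  split; first by apply: measurableT_comp => //; case: bf.
  by case: bf => _ [K fK]; exists K => t /=.
Qed.

(** * Appending one eigenvalue: the beta-weighted averaging step *)

Lemma fctXE (f : R -> R) n : f ^+ n = (fun t => f t ^+ n).
Proof. by elim: n => [|n IH]; apply/funext => t; rewrite ?expr0// exprS IH /= exprS. Qed.

Lemma is_derive_pow (s : R) n : is_derive s 1 (fun t : R => t ^+ n.+1) (n.+1%:R * s ^+ n).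
Proof.
have := @is_deriveX R R id n.+1 s 1 1 (is_derive_id _ _).
by rewrite fctXE => h; apply: is_derive_eq h _; rewrite /GRing.scale /= mulr1.
Qed.

(* Since w (x - c) = y - c for y = c + w (x - c), the derivative of w^(k+1) y^m
   involves only w^k, y^m and y^(m-1); this yields the moment recursion below. *)
Lemma step_derive (c x w : R) k m :
  is_derive w 1 (fun t : R => t ^+ k.+1 * (c + t * (x - c)) ^+ m : R)
   (w ^+ k * ((m + k.+1)%:R * (c + w * (x - c)) ^+ m - m%:R * c * (c + w * (x - c)) ^+ m.-1)).
Proof.
have d1 := is_derive_pow w k.
have d2 : is_derive w 1 (fun t : R => c + t * (x - c)) (x - c).
  by apply: is_derive_eq; rewrite /GRing.scale /=; ring.
have d3 : is_derive w 1 (fun t : R => (c + t * (x - c)) ^+ m)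
    ((m%:R * (c + w * (x - c)) ^+ m.-1) * (x - c)).
  by have := @is_deriveX R R _ m w 1 _ d2; rewrite fctXE.
apply: is_derive_eq (@is_deriveM R R _ _ w 1 _ _ d1 d3) _.
rewrite /GRing.scale /= natrD.
(* At m = 0 the truncated predecessor is harmless: its term carries the factor m. *)
case: m {d3} => [|m] /=; rewrite ?exprS; ring.
Qed.

Lemma affine_pow_continuous (c x : R) p :
  continuous (fun t : R => (c + t * (x - c)) ^+ p).
Proof.
move=> t; apply: (@continuous_comp _ _ _ (fun t : R => c + t * (x - c)) (fun y => y ^+ p)).
  by apply: cvgD; [exact: cvg_cst|apply: cvgM; [exact: cvg_id|exact: cvg_cst]].
exact: exprn_continuous.
Qed.

Lemma step_continuous (c x : R) k m :
  continuous (fun w : R => w ^+ k * ((m + k.+1)%:R * (c + w * (x - c)) ^+ m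
     - m%:R * c * (c + w * (x - c)) ^+ m.-1)).
Proof.
move=> t; apply: cvgM; first exact: exprn_continuous.
by apply: cvgB; (apply: cvgM; first exact: cvg_cst); exact: affine_pow_continuous.
Qed.

Lemma step_integrable (c x : R) k m :
  lebesgue_measure.-integrable `[0, 1] (fun w : R => (w ^+ k * ((m + k.+1)%:R *
    (c + w * (x - c)) ^+ m - m%:R * c * (c + w * (x - c)) ^+ m.-1))%:E).
Proof.
apply: continuous_compact_integrable; first exact: segment_compact.
by apply: continuous_subspaceT; exact: step_continuous.
Qed.

(** Fundamental theorem of calculus: the primitive of [step_derive] is [x ^+ m] at 1 and, since its
    first exponent is positive, vanishes at 0. *)
Lemma step_integral (c x : R) k m :
  (\int[lebesgue_measure]_(w in `[0%R, 1%R]) (w ^+ k * ((m + k.+1)%:R * (c + w * (x - c)) ^+ m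
     - m%:R * c * (c + w * (x - c)) ^+ m.-1))%:E = (x ^+ m)%:E)%E.
Proof.
have cF : continuous (fun t : R => t ^+ k.+1 * (c + t * (x - c)) ^+ m).
  by move=> t; apply: cvgM; [exact: exprn_continuous|exact: affine_pow_continuous].
rewrite (@continuous_FTC2 _ _ (fun t : R => t ^+ k.+1 * (c + t * (x - c)) ^+ m)) //.
- by rewrite expr1n expr0n /= mul0r mul1r sube0; congr (_%:E); congr (_ ^+ _); ring.
- by apply: continuous_subspaceT; exact: step_continuous.
- split.
  + by move=> t _; have := step_derive c x t k m.
  + apply: cvg_at_right_filter; exact: cF.
  + apply: cvg_at_left_filter; exact: cF.
- by move=> t _; rewrite derive1E; apply: derive_val; exact: step_derive.
Qed.

(** The density of [beta_prob k.+1 1] is [w ^+ k / beta_fun k.+1 1] on [0, 1], so this is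
    [step_integral] normalized; [clip 0 1] changes the integrand only off the support, to keep it
    bounded. *)
Lemma beta_integral (c x : R) k m :
  (\int[beta_prob k.+1 1]_w ((m + k.+1)%:R * (c + clip 0 1 w * (x - c)) ^+ m
     - m%:R * c * (c + clip 0 1 w * (x - c)) ^+ m.-1)%:E
   = (x ^+ m / beta_fun k.+1 1)%:E)%E.
Proof.
pose G (w : measurableTypeR R) : R := (m + k.+1)%:R * (c + clip 0 1 w * (x - c)) ^+ m
     - m%:R * c * (c + clip 0 1 w * (x - c)) ^+ m.-1.
have bG : bounded_mfun G.
  have b0 : bounded_mfun (fun w : measurableTypeR R => c + clip 0 1 w * (x - c)).
    apply: bounded_mfunD; first exact: bounded_mfun_cst.
    apply: bounded_mfunM; last exact: bounded_mfun_cst.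
    have mid : measurable_fun [set: measurableTypeR R] (fun w => w : R).
      by move=> _ Y mY; rewrite setTI.
    exact: (bounded_mfun_clip ler01 mid).
  rewrite (_ : G = (fun w => (m + k.+1)%:R * (c + clip 0 1 w * (x - c)) ^+ m)
     \+ (fun w => (- (m%:R * c)) * (c + clip 0 1 w * (x - c)) ^+ m.-1)).
    by apply: bounded_mfunD; (apply: bounded_mfunM; [exact: bounded_mfun_cst|exact: bounded_mfunX]).
  by apply/funext => w; rewrite /G /= mulNr.
rewrite -[LHS]/(\int[beta_prob k.+1 1]_w (G w)%:E)%E.
have mG : measurable_fun [set: measurableTypeR R] (EFin \o G).
  by apply/measurable_EFinP; exact: (proj1 bG).
rewrite integral_beta_prob //; last first.
  have /integrableP[] := @bounded_mfun_integrable _ _ (@beta_prob R k.+1 1) _ (fin_num_measureT _) bG.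
  by [].
rewrite mulrC EFinM -(step_integral c x k m) -integralZl //=; last first.
  exact: step_integrable.
rewrite [RHS]integral_mkcond; apply: eq_integral => /= w _.
rewrite /beta_pdf !patchE; case: ifPn => [|_]; last by rewrite mul0r mule0.
rewrite inE /= in_itv /= => /clip_id w01.
rewrite -!EFinM XMonemXn0 /= /G w01; congr (_%:E); ring.
Qed.

(* The solution nu' is the law of c + w (x - c), for x of law nu and w independent
   of density w^k on [0, 1]. *)
Lemma step_measure a b c (nu : fmeas) k : a <= c <= b ->
  exists nu' : fmeas, forall m,
   (m + k.+1)%:R * moment a b nu' m = m%:R * c * moment a b nu' m.-1 + moment a b nu m.
Proof.
move=> /andP[ac cb]; have ab := le_trans ac cb.
pose P : probability (measurableTypeR R) R := beta_prob k.+1 1.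
pose phi (p : R * measurableTypeR R) := c + clip 0 1 (p.2 : R) * (clip a b p.1 - c).
have phi_itv p : a <= phi p <= b.
  have /andP[u0 u1] := clip_itv (p.2 : R) ler01.
  have /andP[x0 x1] := clip_itv p.1 ab.
  (* A convex combination of c and a point of [[a, b]]. *)
  rewrite /phi; nra.
have mphi : measurable_fun setT phi.
  apply: measurable_funD; first exact: measurable_cst.
  apply: measurable_funM.
    by apply: measurableT_comp; [exact: measurable_clip|exact: measurable_snd].
  apply: measurable_funB; last exact: measurable_cst.
  by apply: measurableT_comp; [exact: measurable_clip|exact: measurable_fst].
have bphi : bounded_mfun phi.
  by split => //; exists (`|a| + `|b|) => p; exact: norm_itv_le.
have prodT : ((nu \x P) setT < +oo)%E.
  rewrite -setXTT product_measure1E //= probability_setT mule1.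
  exact: fin_num_measureT.
have [nu0 nu0E] := finite_pushforward prodT mphi.
have mom0 m : moment a b nu0 m = (\int[(nu \x P)%E]_p (phi p ^+ m))%R.
  rewrite /moment (Rintegral_pushforward prodT mphi nu0E).
    by apply: eq_Rintegral => p _; rewrite clip_id.
  exact: bounded_pow_clip.
have iphi m : (nu \x P)%E.-integrable setT (EFin \o (fun p => phi p ^+ m)).
  by apply: bounded_mfun_integrable => //; exact: bounded_mfunX.
have beta0 : beta_fun k.+1 1 != 0 :> R by rewrite gt_eqF // beta_fun_gt0.
have key m : (m + k.+1)%:R * moment a b nu0 m - m%:R * c * moment a b nu0 m.-1
    = moment a b nu m / beta_fun k.+1 1.
  have b1 : bounded_mfun (fun p => (m + k.+1)%:R * phi p ^+ m).
    by apply: bounded_mfunM; [exact: bounded_mfun_cst|exact: bounded_mfunX].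
  have b2 : bounded_mfun (fun p => m%:R * c * phi p ^+ m.-1).
    by apply: bounded_mfunM; [exact: bounded_mfun_cst|exact: bounded_mfunX].
  have i1 := bounded_mfun_integrable prodT b1.
  have i2 := bounded_mfun_integrable prodT b2.
  rewrite !mom0 -(RintegralZl _ measurableT (iphi m)) -(RintegralZl _ measurableT (iphi m.-1)).
  rewrite -(RintegralB measurableT i1 i2).
  have i3 := integrableB measurableT i1 i2.
  (* Fubini: for fixed x the inner integral over w is the one of [beta_integral]. *)
  rewrite /Rintegral -(integral12_prod_meas1 i3).
  rewrite /moment -RintegralZr //; last first.
    apply: bounded_mfun_integrable; first exact: fin_num_measureT.
    exact: bounded_pow_clip.
  congr fine; apply: eq_integral => x _.
  by rewrite -(beta_integral c (clip a b x) k m).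
(* Scaling by the beta constant undoes the normalization of the probability density. *)
pose r : {nonneg R} := NngNum (beta_fun_ge0 k.+1 1).
pose nu' : fmeas := mscale r nu0.
have momE m : moment a b nu' m = beta_fun k.+1 1 * moment a b nu0 m.
  rewrite /moment /nu' Rintegral_mscale //.
  exact: bounded_pow_clip.
exists nu' => m; rewrite !momE.
have := congr1 (fun z : R => beta_fun k.+1 1 * z) (key m).
rewrite mulrBr mulrCA [in X in _ = X]mulrCA divff // mulr1 => <-; ring.
Qed.
End Moments.

(** * Moment sequences of differences of finite measures *)

Section MomentRep.
Context {R : realType}.
Variables (a b : R).
Hypothesis ab : a <= b.
Local Notation fmeas := {finite_measure set R -> \bar R}.
Local Notation moment := (moment a b).

Lemma moment_integrable (mu : fmeas) m : mu.-integrable setT (EFin \o (fun x => clip a b x ^+ m)).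
Proof.
apply: bounded_mfun_integrable; first exact: fin_num_measureT.
exact: bounded_pow_clip.
Qed.

Lemma moment0 (mu : fmeas) : moment mu 0 = mass mu.
Proof.
rewrite /moment; under eq_Rintegral do rewrite expr0.
by rewrite Rintegral_cst // mul1r.
Qed.

Lemma mass_ge0 (mu : fmeas) : 0 <= mass mu.
Proof. by apply: fine_ge0. Qed.

Lemma finite_measure_add (mu nu : fmeas) :
  exists r : fmeas, (r : set R -> \bar R) = measure_add mu nu.
Proof.
apply: (@finite_measure_of R (measure_add mu nu)).
rewrite -[X in (X < _)%E]/(measure_add mu nu setT) measure_addE.
by rewrite lte_add_pinfty // fin_num_measureT.
Qed.

Lemma moment_add (mu nu r : fmeas) m : (r : set R -> \bar R) = measure_add mu nu ->
  moment r m = moment mu m + moment nu m.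
Proof.
move=> rE; rewrite /moment /Rintegral.
have -> : (\int[r]_x (clip a b x ^+ m)%:E)%E = (\int[measure_add mu nu]_x (clip a b x ^+ m)%:E)%E.
  by rewrite -rE.
rewrite (integral_measure_add measurableT (moment_integrable mu m) (moment_integrable nu m)).
by rewrite fineD //; exact: integrable_fin_num (moment_integrable _ m).
Qed.

(** Moments of a signed measure, with control of the total mass: [K] is what later makes the sum
    over the orders in B converge. *)
Definition moment_rep (K : R) (q : nat -> R) : Prop :=
  exists mu nu : fmeas, mass mu + mass nu <= K /\
    forall m, q m = moment mu m - moment nu m.

Lemma moment_repD K L q r : moment_rep K q -> moment_rep L r ->
  moment_rep (K + L) (fun m => q m + r m).
Proof.
move=> [mu [nu [h1 h2]]] [mu' [nu' [h3 h4]]].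
have [m1 m1E] := finite_measure_add mu mu'.
have [m2 m2E] := finite_measure_add nu nu'.
exists m1, m2; split.
  rewrite /mass m1E m2E !measure_addE !fineD ?fin_num_measure //.
  by move: h1 h3; rewrite /mass; lra.
by move=> m; rewrite (moment_add m m1E) (moment_add m m2E) h2 h4; ring.
Qed.

Lemma moment_rep_scale_ge0 K q c : 0 <= c -> moment_rep K q ->
  moment_rep (c * K) (fun m => c * q m).
Proof.
move=> c0 [mu [nu [h1 h2]]]; pose r : {nonneg R} := NngNum c0.
exists (mscale r mu), (mscale r nu); split.
  by rewrite /mass /= /mscale !fineM ?fin_num_measure //= -mulrDr ler_wpM2l.
move=> m; rewrite h2 /moment !Rintegral_mscale /= ?mulrBr //;
exact: bounded_pow_clip.
Qed.

Lemma moment_repN K q : moment_rep K q -> moment_rep K (fun m => - q m).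
Proof.
move=> [mu [nu [h1 h2]]]; exists nu, mu; split; first by rewrite addrC.
by move=> m; rewrite h2 opprB.
Qed.

Lemma eq_moment_rep K q r : q =1 r -> moment_rep K q -> moment_rep K r.
Proof. by move=> /funext ->. Qed.

Lemma moment_rep_le K L q : K <= L -> moment_rep K q -> moment_rep L q.
Proof.
move=> KL [mu [nu [h1 h2]]]; exists mu, nu; split => //; exact: le_trans KL.
Qed.

Lemma moment_repZ K q c : moment_rep K q -> moment_rep (`|c| * K) (fun m => c * q m).
Proof.
move=> h; have [c0|c0] := leP 0 c.
  by rewrite ger0_norm //; exact: moment_rep_scale_ge0.
rewrite ltr0_norm //; have nc0 : 0 <= - c by lra.
apply: (eq_moment_rep _ (moment_repN (moment_rep_scale_ge0 nc0 h))) => m.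
by rewrite mulNr opprK.
Qed.

Lemma moment_rep_dirac c : a <= c <= b -> moment_rep 1 (fun m => c ^+ m).
Proof.
move=> /clip_id cE; pose d : fmeas := @dirac _ R c R.
pose z : fmeas := mscale (NngNum (lexx (0:R)) : {nonneg R}) d.
have bf m := bounded_pow_clip m ab.
exists d, z; split.
  rewrite /mass; have -> : z setT = 0%E by rewrite -[LHS]/(0%:E * d setT)%E mul0e.
  by rewrite addr0 -[d setT]/(\d_c setT) diracT.
move=> m; rewrite /moment /z Rintegral_mscale //= mul0r subr0 /Rintegral.
rewrite integral_dirac //; last by apply/measurable_EFinP; case: (bf m).
by rewrite diracT mul1e /= cE.
Qed.

Lemma moment_rep0 : moment_rep 0 (fun=> 0).
Proof.
have aab : a <= a <= b by rewrite lexx.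
have := moment_rep_scale_ge0 (lexx 0) (moment_rep_dirac aab).
by rewrite mul0r; apply: eq_moment_rep => m; rewrite mul0r.
Qed.

Lemma moment_rep_sum (I : finType) (K : I -> R) (q : I -> nat -> R) :
  (forall i, moment_rep (K i) (q i)) ->
  moment_rep (\sum_i K i) (fun m => \sum_i q i m).
Proof.
move=> h; elim: (index_enum I) => [|i s IH].
  by rewrite big_nil; apply: eq_moment_rep moment_rep0 => m; rewrite big_nil.
rewrite big_cons; apply: eq_moment_rep (moment_repD (h i) IH) => m.
by rewrite big_cons.
Qed.

(** The recursion at m = 0 says that the step divides masses by [k.+1]; iterated, this is the source
    of the factor 1 / k!. *)
Lemma moment_rep_step K q c k : a <= c <= b -> moment_rep K q ->
  exists q', moment_rep (K / k.+1%:R) q' /\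
   forall m, (m + k.+1)%:R * q' m = m%:R * c * q' m.-1 + q m.
Proof.
move=> acb [mu [nu [h1 h2]]].
have [mu' muE] := step_measure mu k acb.
have [nu' nuE] := step_measure nu k acb.
exists (fun m => moment mu' m - moment nu' m); split; last first.
  by move=> m; rewrite mulrBr muE nuE h2; ring.
exists mu', nu'; split => //.
have := muE 0%N; have := nuE 0%N; rewrite !add0n !mul0r !add0r !moment0 => e1 e2.
by rewrite ler_pdivlMr ?ltr0n // mulrC mulrDr e1 e2.
Qed.
End MomentRep.

(** * Sums of words in two noncommuting letters *)

Section Words.
Variables (T : pzRingType) (A B : T).

(** Recursion on the last letter; the nested fixpoint makes the lexicographic descent in k, then m,
    structural. *)
Fixpoint word (k : nat) : nat -> T :=
  if k is k'.+1 then
    fix aux m := if m is m'.+1 then aux m' * A + word k' m * B else word k' 0%N * B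
  else fun m => A ^+ m.

Lemma word0E m : word 0 m = A ^+ m. Proof. by []. Qed.
Lemma word0S m : word 0 m.+1 = word 0 m * A. Proof. exact: exprSr. Qed.
Lemma wordS0 k : word k.+1 0 = word k 0 * B. Proof. by []. Qed.
Lemma wordSS k m : word k.+1 m.+1 = word k.+1 m * A + word k m.+1 * B.
Proof. by []. Qed.

Lemma word0S_l m : word 0 m.+1 = A * word 0 m. Proof. exact: exprS. Qed.

Lemma wordS0_l k : word k.+1 0 = B * word k 0.
Proof. by elim: k => [|k IH]; rewrite wordS0 ?expr0 ?mul1r ?mulr1 // {1}IH -mulrA. Qed.

(** The first-letter recursion is wanted because taking adjoints reverses words. In the generic case
    both recursions, applied one after the other, group the words by their first and last
    letters. *)
Lemma wordSS_l k m : word k.+1 m.+1 = A * word k.+1 m + B * word k m.+1.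
Proof.
elim: k m => [|k IHk]; elim => [|m IHm].
- rewrite wordSS [RHS]addrC; congr (_ + _); first by rewrite wordS0 /= expr0 expr1 mul1r.
  by rewrite /= expr1 expr0 mul1r.
- rewrite wordSS {1}IHm [word 1 m.+1]wordSS [word 0 m.+2 in RHS]word0S (word0S_l m.+1).
  by rewrite mulrDl mulrDr !mulrA addrAC.
- rewrite wordSS {1}IHk [word k.+2 0 in LHS]wordS0_l [word k.+2 0]wordS0 [word k.+1 1]wordSS.
  by rewrite mulrDl !mulrDr !mulrA addrCA.
- transitivity (word k.+2 m.+1 * A + word k.+1 m.+2 * B); first exact: wordSS.
  transitivity (A * (word k.+2 m * A + word k.+1 m.+1 * B) +
                B * (word k.+1 m.+1 * A + word k m.+2 * B)); last first.
    by rewrite -!wordSS.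
  rewrite (IHk m.+1) IHm; move: (word _ _) (word _ _) (word _ _) => X Y Z.
  by rewrite !mulrDl !mulrDr !mulrA addrACA.
Qed.
End Words.
Arguments word : simpl never.

(** * The noncommutative binomial formula *)

Section Expansion.
Variable (K : comNzRingType).

(** Multiplying by [t *: A + B] on the right appends a letter, and words are regrouped by their
    number k of letters B. *)
Lemma exp_scale_add n (A B : 'M[K]_n) (t : K) N :
  (t *: A + B) ^+ N = \sum_(k < N.+1) t ^+ (N - k) *: word A B k (N - k).
Proof.
elim: N => [|N IH]; first by rewrite big_ord_recl big_ord0 addr0 subnn !expr0 scale1r.
rewrite exprSr IH mulrDr !mulr_suml.
rewrite [RHS]big_ord_recl /= subn0.
(* Words containing a B, split by last letter. At i = N there is no letter A left, hence the shorter
   second sum. *)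
have -> : \sum_(i < N.+1) t ^+ (N.+1 - bump 0 i) *: word A B (bump 0 i) (N.+1 - bump 0 i) =
  \sum_(i < N.+1) t ^+ (N - i) *: (word A B i (N - i) * B) +
  \sum_(i < N) t ^+ (N - i) *: (word A B i.+1 (N - i.+1) * A).
  rewrite !big_ord_recr /= !subSS !subnn !expr0 !scale1r addrAC; congr (_ + _).
  rewrite -big_split /=; apply: eq_bigr => i _; rewrite /bump /= add1n subSS.
  have iN := ltn_ord i; rewrite -(subnSK iN) wordSS.
  by rewrite -scalerDr addrC.
rewrite [X in X + _]big_ord_recl /= subn0.
have s1 (X Y : 'M[K]_n) (s : K) : (s *: X) * (t *: Y) = (s * t) *: (X * Y).
  by rewrite -[LHS]/((s *: X) *m (t *: Y)) -scalemxAl -scalemxAr scalerA.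
rewrite s1 -exprSr -word0S -addrA; congr (_ + _).
rewrite addrC; congr (_ + _); apply: eq_bigr => i _.
  by rewrite [LHS]/GRing.mul /= scalemxAl.
by rewrite s1 -exprSr /bump /= add1n -(subnSK (ltn_ord i)).
Qed.

Lemma word_conj n (P Q D B : 'M[K]_n) k m : Q *m P = 1%:M -> P *m Q = 1%:M ->
  word (Q *m D *m P) (Q *m B *m P) k m = Q *m word D B k m *m P.
Proof.
move=> QP PQ; have mm (X Y : 'M[K]_n) : (Q *m X *m P) * (Q *m Y *m P) = Q *m (X * Y) *m P.
  by rewrite -[LHS]/(_ *m _) !mulmxA -(mulmxA _ P Q) PQ mulmx1.
have ex : word (Q *m D *m P) (Q *m B *m P) 0 = fun m => Q *m word D B 0 m *m P.
  apply/funext; elim => [|p IH]; first by rewrite !word0E !expr0 mulmx1 QP.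
  by rewrite !word0S IH mm.
elim: k m => [|k IHk] m; first by rewrite ex.
elim: m => [|m IHm]; first by rewrite !wordS0 IHk mm.
by rewrite !wordSS IHm IHk !mm mulmxDr mulmxDl.
Qed.
End Expansion.

(** * Complex moment sequences and the words of a diagonal matrix *)

Section ComplexRep.
Context {R : realType}.
Local Notation C := R[i].
Local Notation Re := (@complex.Re R).
Local Notation Im := (@complex.Im R).

Lemma Re_mul (z w : C) : Re (z * w) = Re z * Re w - Im z * Im w.
Proof. by case: z w => [x y] [u v]. Qed.

Lemma Im_mul (z w : C) : Im (z * w) = Re z * Im w + Im z * Re w.
Proof. by case: z w => [x y] [u v]. Qed.

Lemma Re_sum (I : Type) (s : seq I) (P : pred I) (F : I -> C) :
  Re (\sum_(i <- s | P i) F i) = \sum_(i <- s | P i) Re (F i).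
Proof. exact: (big_morph Re (fun x y => raddfD _ x y) (raddf0 _)). Qed.

Lemma Im_sum (I : Type) (s : seq I) (P : pred I) (F : I -> C) :
  Im (\sum_(i <- s | P i) F i) = \sum_(i <- s | P i) Im (F i).
Proof. exact: (big_morph Im (fun x y => raddfD _ x y) (raddf0 _)). Qed.

(** Used rather than the modulus because real and imaginary parts have separate measures: this is
    the factor by which multiplication by z enlarges the mass bound of either part. *)
Definition l1norm (z : C) : R := `|Re z| + `|Im z|.

Lemma l1norm_ge0 z : 0 <= l1norm z. Proof. by rewrite addr_ge0. Qed.

Variables (a b : R).
Hypothesis ab : a <= b.

Definition cmoment_rep (K : R) (q : nat -> C) : Prop :=
  moment_rep a b K (fun m => Re (q m)) /\ moment_rep a b K (fun m => Im (q m)).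

Lemma cmoment_repZ K q w : cmoment_rep K q -> cmoment_rep (l1norm w * K) (fun m => w * q m).
Proof.
move=> [hr hi]; rewrite /l1norm mulrDl; split.
- have := moment_repD ab (moment_repZ ab (Re w) hr) (moment_repN (moment_repZ ab (Im w) hi)).
  by apply: eq_moment_rep => m; rewrite Re_mul.
- have := moment_repD ab (moment_repZ ab (Re w) hi) (moment_repZ ab (Im w) hr).
  by apply: eq_moment_rep => m; rewrite Im_mul.
Qed.

Lemma cmoment_rep_sum (I : finType) (K : I -> R) (q : I -> nat -> C) :
  (forall i, cmoment_rep (K i) (q i)) ->
  cmoment_rep (\sum_i K i) (fun m => \sum_i q i m).
Proof.
move=> h; split.
- have := moment_rep_sum ab (fun i => proj1 (h i)).
  by apply: eq_moment_rep => m; rewrite Re_sum.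
- have := moment_rep_sum ab (fun i => proj2 (h i)).
  by apply: eq_moment_rep => m; rewrite Im_sum.
Qed.

Lemma cmoment_rep_le K L q : K <= L -> cmoment_rep K q -> cmoment_rep L q.
Proof. by move=> KL [h1 h2]; split; exact: moment_rep_le KL _. Qed.

Lemma eq_cmoment_rep K q r : q =1 r -> cmoment_rep K q -> cmoment_rep K r.
Proof. by move=> /funext ->. Qed.

(** A crude norm above every row sum and every column sum, so that one constant serves all entries
    of a product. *)
Definition l1mx m n (X : 'M[C]_(m, n)) : R := \sum_i \sum_j l1norm (X i j).

Lemma l1mx_ge0 m n (X : 'M[C]_(m, n)) : 0 <= l1mx X.
Proof. by apply: sumr_ge0 => i _; apply: sumr_ge0 => j _; exact: l1norm_ge0. Qed.

Lemma l1mx_row m n (X : 'M[C]_(m, n)) i : \sum_j l1norm (X i j) <= l1mx X.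
Proof.
rewrite /l1mx (bigD1 i) //= lerDl; apply: sumr_ge0 => k _; apply: sumr_ge0 => j _.
exact: l1norm_ge0.
Qed.

Lemma l1mx_col m n (X : 'M[C]_(m, n)) j : \sum_i l1norm (X i j) <= l1mx X.
Proof.
apply: ler_sum => i _; rewrite (bigD1 j) //= lerDl; apply: sumr_ge0 => k _.
exact: l1norm_ge0.
Qed.

Lemma cmoment_rep_mulmxr m n p K (q : nat -> 'M[C]_(m, n)) (X : 'M[C]_(n, p)) :
  0 <= K -> (forall i j, cmoment_rep K (fun k => q k i j)) ->
  forall i j, cmoment_rep (l1mx X * K) (fun k => (q k *m X) i j).
Proof.
move=> K0 h i j; apply: (@cmoment_rep_le (\sum_l l1norm (X l j) * K)).
  by rewrite -mulr_suml ler_wpM2r // l1mx_col.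
have := cmoment_rep_sum (fun l => cmoment_repZ (X l j) (h i l)).
by apply: eq_cmoment_rep => k; rewrite mxE; apply: eq_bigr => l _; rewrite mulrC.
Qed.

Lemma cmoment_rep_mulmxl m n p K (q : nat -> 'M[C]_(n, p)) (X : 'M[C]_(m, n)) :
  0 <= K -> (forall i j, cmoment_rep K (fun k => q k i j)) ->
  forall i j, cmoment_rep (l1mx X * K) (fun k => (X *m q k) i j).
Proof.
move=> K0 h i j; apply: (@cmoment_rep_le (\sum_l l1norm (X i l) * K)).
  by rewrite -mulr_suml ler_wpM2r // l1mx_row.
have := cmoment_rep_sum (fun l => cmoment_repZ (X i l) (h l j)).
by apply: eq_cmoment_rep => k; rewrite mxE.
Qed.

Lemma natr_fact_neq0 p : p`!%:R != 0 :> R.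
Proof. by rewrite pnatr_eq0 -lt0n fact_gt0. Qed.

Lemma natrS_neq0 p : 1 + p%:R != 0 :> R.
Proof. by rewrite addrC natr1 pnatr_eq0. Qed.

(* The k-th order term of int lambda^m M(d lambda) is [wcoef k m * word A B k m]. *)
Definition wcoef (k m : nat) : R := m`!%:R / (m + k)`!%:R.

Lemma wcoef0 m : wcoef 0 m = 1.
Proof. by rewrite /wcoef addn0 divff // natr_fact_neq0. Qed.

Lemma wcoefS0 k : k.+1%:R * wcoef k.+1 0 = wcoef k 0.
Proof.
by rewrite /wcoef !add0n factS natrM; field; rewrite natr_fact_neq0 natrS_neq0.
Qed.

(** Together with [wcoefSr], the reason for the weight m! / (m + k)!: multiplied by [m.+1 + k.+1],
    the weighted last-letter recursion of [word] becomes the moment recursion of [step_measure]. *)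
Lemma wcoefSl k m : (m.+1 + k.+1)%:R * wcoef k.+1 m.+1 = m.+1%:R * wcoef k.+1 m.
Proof.
rewrite /wcoef addSn !factS !natrM; field.
rewrite natr_fact_neq0 /=; have := natrS_neq0 (m + k.+1).
by rewrite natrD -natr1 [k%:R + 1]addrC.
Qed.

Lemma wcoefSr k m : (m.+1 + k.+1)%:R * wcoef k.+1 m.+1 = wcoef k m.+1.
Proof.
rewrite /wcoef (addnS m.+1) [(m.+1 + k).+1`!]factS natrM; field.
rewrite natr_fact_neq0 /=; have := natrS_neq0 (m.+1 + k).
by rewrite natrD -natr1 [m%:R + 1]addrC.
Qed.

(** Induction on k. A final B is a matrix product, at the price of a factor [l1mx B] in mass; a
    final diagonal letter multiplies column j by [d j], so the final run of such letters is one
    moment step with c = [d j], which gains the factor 1 / (k + 1). *)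
Lemma word_diag_rep n (d : 'I_n -> R) (B : 'M[C]_n) k :
  (forall i, a <= d i <= b) -> forall i j,
  cmoment_rep (l1mx B ^+ k / k`!%:R)
    (fun m => (wcoef k m)%:C%C * word (diag_mx (\row_l (d l)%:C%C)) B k m i j).
Proof.
move=> dab; elim: k => [|k IH] i j.
  (* For k = 0 the entries are moments of a point mass at [d j], or zero off the diagonal. *)
  rewrite expr0 fact0 divr1; apply: (@eq_cmoment_rep _ (fun m => (i == j)%:R * (d j)%:C%C ^+ m)).
    move=> m; rewrite wcoef0 mul1r word0E; elim: m => [|m IHm].
      by rewrite !expr0 mulr1 mxE.
    rewrite exprSr [in RHS]exprSr [(_ * diag_mx _)]mul_mx_diag mxE -IHm mulrA.
    by rewrite !mxE.
  have [_|_] := eqVneq i j; last first.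
    split; (apply: moment_rep_le ler01 _); apply: (eq_moment_rep _ (moment_rep0 ab)) => m;
    by rewrite mul0r.
  split.
    apply: (eq_moment_rep _ (moment_rep_dirac ab (dab j))) => m.
    by rewrite mul1r -rmorphXn.
  apply: (moment_rep_le ler01); apply: (eq_moment_rep _ (moment_rep0 ab)) => m.
  by rewrite mul1r -rmorphXn.
have K0 : 0 <= l1mx B ^+ k / k`!%:R by rewrite divr_ge0 ?exprn_ge0 ?l1mx_ge0.
have IH' i' j' : cmoment_rep (l1mx B ^+ k / k`!%:R)
    (fun m => ((wcoef k m)%:C%C *: word (diag_mx (\row_l (d l)%:C%C)) B k m) i' j').
  by apply: eq_cmoment_rep (IH i' j') => m; rewrite mxE.
have [repr repi] := cmoment_rep_mulmxr B K0 IH' i j.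
have [qr [qrrep qrE]] := moment_rep_step k (dab j) repr.
have [qi [qirep qiE]] := moment_rep_step k (dab j) repi.
have KE : l1mx B * (l1mx B ^+ k / k`!%:R) / k.+1%:R = l1mx B ^+ k.+1 / k.+1`!%:R.
  rewrite factS natrM exprS; field; by rewrite natr_fact_neq0 natrS_neq0.
rewrite KE in qrrep qirep.
(* The moment recursion has only one solution, so the sequence supplied by the step is the wanted
   one; [f] stands for the real or the imaginary part. *)
have rec (f : C -> R) (q : nat -> R) :
    (forall z w, f (z + w) = f z + f w) -> (forall x z, f (x%:C%C * z) = x * f z) ->
    (forall m, (m + k.+1)%:R * q m = m%:R * d j * q m.-1 +
       f (((wcoef k m)%:C%C *: word (diag_mx (\row_l (d l)%:C%C)) B k m *m B) i j)) ->
    forall m, q m = f ((wcoef k.+1 m)%:C%C * word (diag_mx (\row_l (d l)%:C%C)) B k.+1 m i j).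
  move=> fD fZ qE; elim => [|m IHm].
    have n0 : k.+1%:R != 0 :> R by rewrite pnatr_eq0.
    apply: (mulfI n0); have := qE 0%N; rewrite add0n !mul0r add0r => ->.
    by rewrite -scalemxAl mxE !fZ mulrA wcoefS0 wordS0.
  have n0 : (m.+1 + k.+1)%:R != 0 :> R by rewrite addSn pnatr_eq0.
  set W := word _ _ in IHm qE *.
  have wE : W k.+1 m.+1 i j = (d j)%:C%C * W k.+1 m i j + (W k m.+1 *m B) i j.
    rewrite /W wordSS [LHS]mxE; congr (_ + _).
    by rewrite [(_ * diag_mx _)]mul_mx_diag mxE [in LHS]mxE mulrC.
  have sE : ((wcoef k m.+1)%:C%C *: W k m.+1 *m B) i j = (wcoef k m.+1)%:C%C * (W k m.+1 *m B) i j.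
    by rewrite -scalemxAl mxE.
  apply: (mulfI n0); rewrite qE /= IHm sE wE !fZ fD fZ mulrDr mulrDr.
  rewrite -(wcoefSr k m) -(mulrA m.+1%:R) (mulrCA (d j)) (mulrA m.+1%:R (wcoef _ _)).
  by rewrite -(wcoefSl k m); ring.
split; [apply: (eq_moment_rep _ qrrep)|apply: (eq_moment_rep _ qirep)]; apply: rec => //.
- by move=> z w; rewrite raddfD.
- by move=> x z; rewrite Re_mul /= mul0r subr0.
- by move=> z w; rewrite raddfD.
- by move=> x z; rewrite Im_mul /= mul0r addr0.
Qed.
End ComplexRep.

(** * Taylor remainders of the complex exponential *)

Section CexpTaylor.
Context {R : realType}.
Local Notation C := R[i].
Local Notation Re := (@complex.Re R).
Local Notation Im := (@complex.Im R).

(** Mean value theorem for the difference of the two sides, whose derivative is nonpositive on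
    [0, 1]. *)
Lemma derivative_le (F f : R -> R) (c : R) n :
  (forall s : R, is_derive s 1 F (f s)) -> F 0 = 0 ->
  (forall s, 0 <= s <= 1 -> f s <= c * s ^+ n) ->
  forall s, 0 <= s <= 1 -> F s <= c / n.+1%:R * s ^+ n.+1.
Proof.
move=> dF F0 fle s /andP[s0 s1].
pose h x := F x - c / n.+1%:R * x ^+ n.+1.
have dh (x : R) : is_derive x 1 h (f x - c * x ^+ n).
  have d2 := @is_deriveZ R R R _ (c / n.+1%:R) x 1 _ (is_derive_pow x n).
  apply: is_derive_eq (@is_deriveB R R R _ _ x 1 _ _ (dF x) d2) _.
  by rewrite /GRing.scale /= mulrA mulfVK // pnatr_eq0.
have ch : {within `[0, s], continuous h}.
  by apply: derivable_within_continuous => x _; have := dh x.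
have [x] := @MVT_segment R h _ 0 s s0 (fun x _ => dh x) ch.
rewrite in_itv /= => /andP[x0 xs]; rewrite /h F0 expr0n /= mulr0 subr0 => hE.
have x01 : 0 <= x <= 1 by rewrite x0 (le_trans xs).
have := fle x x01; rewrite -subr_le0 => le0.
rewrite -subr_le0; move: hE; rewrite !subr0 => ->.
by rewrite mulr_le0_ge0.
Qed.

Lemma derivative_norm_le (F f : R -> R) (c : R) n :
  (forall s : R, is_derive s 1 F (f s)) -> F 0 = 0 ->
  (forall s, 0 <= s <= 1 -> `|f s| <= c * s ^+ n) ->
  forall s, 0 <= s <= 1 -> `|F s| <= c / n.+1%:R * s ^+ n.+1.
Proof.
move=> dF F0 fle s s01; rewrite ler_norml; apply/andP; split; last first.
  apply: (derivative_le dF F0) => // t t01; exact: le_trans (ler_norm _) (fle t t01).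
rewrite lerNl; apply: (@derivative_le (\- F) (\- f)) => //.
- by rewrite /= F0 oppr0.
- move=> t t01; apply: le_trans (fle t t01); by rewrite -normrN ler_norm.
Qed.

Variable z : C.

(** For [f] the real or imaginary part, the Taylor polynomial of exp(s z). A general [f] keeps the
    family closed under differentiation in s, which replaces f by w -> f(z w). *)
Definition taylor (f : C -> R) N (s : R) : R := \sum_(m < N) f (z ^+ m) * (s ^+ m / m`!%:R).

Lemma taylor_derive f N (s : R) :
  is_derive s 1 (taylor f N.+1) (taylor (fun w => f (z * w)) N s).
Proof.
elim: N => [|N IH].
  rewrite /taylor big_ord0.
  have -> : (fun s : R => \sum_(m < 1) f (z ^+ m) * (s ^+ m / m`!%:R)) = cst (f 1).
    by apply/funext => t; rewrite big_ord1 expr0 fact0 divr1 expr0 mulr1.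
  exact: is_derive_cst.
rewrite /taylor big_ord_recr /=.
have -> : (fun s : R => \sum_(m < N.+2) f (z ^+ m) * (s ^+ m / m`!%:R)) =
  taylor f N.+1 + (fun s => f (z ^+ N.+1) / N.+1`!%:R * s ^+ N.+1).
  apply/funext => t; rewrite big_ord_recr [RHS]/(_ + _) /= /taylor; congr (_ + _).
  by rewrite mulrCA mulrC.
have dN := @is_deriveZ R R R _ (f (z ^+ N.+1) / N.+1`!%:R) s 1 _ (is_derive_pow s N).
apply: is_derive_eq (@is_deriveD R R R _ _ s 1 _ _ IH dN) _.
rewrite /GRing.scale /= /taylor; congr (_ + _).
rewrite factS natrM exprS; field.
by rewrite natr_fact_neq0 natrS_neq0.
Qed.

Lemma taylor0 f N : taylor f N.+1 0 = f 1.
Proof.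
rewrite /taylor big_ord_recl /= !expr0 fact0 divr1 mulr1 big1 ?addr0 // => i _.
by rewrite expr0n /= mul0r mulr0.
Qed.

Let x := Re z.
Let y := Im z.

(** [u] and [v] are the real and imaginary parts of exp(s z) along the segment from 0 to z. *)
Let u (s : R) : R := expR (x * s) * cos (y * s).
Let v (s : R) : R := expR (x * s) * sin (y * s).

Let dscale (c s : R) : is_derive s 1 (fun s : R => c * s) c.
Proof.
apply: is_derive_eq (@is_deriveZ R R R _ c s 1 _ (is_derive_id _ _)) _.
by rewrite /GRing.scale /= mulr1.
Qed.

Let du (s : R) : is_derive s 1 u (x * u s - y * v s).
Proof.
have de := is_derive1_comp (is_derive_expR (x * s)) (dscale x s).
have dc := is_derive1_comp (is_derive_cos (y * s)) (dscale y s).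
apply: is_derive_eq (is_deriveM de dc) _.
by rewrite /GRing.scale /= /u /v; ring.
Qed.

Let dv (s : R) : is_derive s 1 v (x * v s + y * u s).
Proof.
have de := is_derive1_comp (is_derive_expR (x * s)) (dscale x s).
have dc := is_derive1_comp (is_derive_sin (y * s)) (dscale y s).
apply: is_derive_eq (is_deriveM de dc) _.
by rewrite /GRing.scale /= /u /v; ring.
Qed.

Let taylor_ReM N s : taylor (fun w => Re (z * w)) N s = x * taylor Re N s - y * taylor Im N s.
Proof.
rewrite /taylor !mulr_sumr -sumrB; apply: eq_bigr => i _.
by rewrite Re_mul -/x -/y; ring.
Qed.

Let taylor_ImM N s : taylor (fun w => Im (z * w)) N s = x * taylor Im N s + y * taylor Re N s.
Proof.
rewrite /taylor !mulr_sumr -big_split; apply: eq_bigr => i _ /=.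
by rewrite Im_mul -/x -/y; ring.
Qed.

(** The derivative of the remainder after N + 1 terms is z times the remainder after N terms, so
    each integration contributes [l1norm z] and a factor s / (N + 1). The base case is |exp(s z)| <=
    exp |Re z|. *)
Lemma cexp_taylor_itv N (s : R) : 0 <= s <= 1 ->
  `|u s - taylor Re N s| <= expR `|x| * l1norm z ^+ N / N`!%:R * s ^+ N /\
  `|v s - taylor Im N s| <= expR `|x| * l1norm z ^+ N / N`!%:R * s ^+ N.
Proof.
elim: N s => [|N IH] s s01.
  rewrite /taylor !big_ord0 !expr0 !subr0 fact0 divr1 !mulr1 /u /v !normrM.
  have e1 : `|expR (x * s)| <= expR `|x|.
    rewrite ger0_norm ?expR_ge0 // ler_expR; case/andP: s01 => s0 s1.
    by rewrite (le_trans (ler_norm _)) // normrM (ger0_norm s0) ler_piMr.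
  split; rewrite -[leRHS]mulr1 ler_pM // ler_norml.
    by rewrite cos_geN1 cos_le1.
  by rewrite sin_geN1 sin_le1.
set c := expR `|x| * l1norm z ^+ N / N`!%:R in IH.
have -> : expR `|x| * l1norm z ^+ N.+1 / N.+1`!%:R = (l1norm z * c) / N.+1%:R.
  rewrite /c factS natrM exprS; field.
  by rewrite natr_fact_neq0 natrS_neq0.
have bnd (p q : R) (t : R) w1 w2 : `|w1| <= c * t ^+ N -> `|w2| <= c * t ^+ N ->
    `|p| + `|q| = l1norm z -> `|p * w1 + q * w2| <= l1norm z * c * t ^+ N.
  move=> h1 h2 <-; apply: le_trans (ler_normD _ _) _.
  rewrite !normrM mulrDl mulrDl -(mulrA `|p|) -(mulrA `|q|).
  by apply: lerD; rewrite ler_wpM2l.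
split.
- apply: (@derivative_norm_le (fun s => u s - taylor Re N.+1 s)
    (fun s => x * u s - y * v s - taylor (fun w => Re (z * w)) N s)) => //.
  + by move=> t; exact: (is_deriveB (du t) (taylor_derive Re N t)).
  + by rewrite taylor0 /u !mulr0 expR0 cos0 mulr1 subrr.
  + move=> t t01; have [h1 h2] := IH t t01.
    rewrite taylor_ReM (_ : _ - _ = x * (u t - taylor Re N t) + - y * (v t - taylor Im N t));
      last by ring.
    by apply: bnd => //; rewrite normrN.
- apply: (@derivative_norm_le (fun s => v s - taylor Im N.+1 s)
    (fun s => x * v s + y * u s - taylor (fun w => Im (z * w)) N s)) => //.
  + by move=> t; exact: (is_deriveB (dv t) (taylor_derive Im N t)).
  + by rewrite taylor0 /v !mulr0 sin0 mulr0 subrr.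
  + move=> t t01; have [h1 h2] := IH t t01.
    rewrite taylor_ImM (_ : _ - _ = x * (v t - taylor Im N t) + y * (u t - taylor Re N t));
      last by ring.
    exact: bnd.
Qed.

Lemma cexp_taylor N :
  `|Re (cexp z) - taylor Re N 1| <= expR `|x| * l1norm z ^+ N / N`!%:R /\
  `|Im (cexp z) - taylor Im N 1| <= expR `|x| * l1norm z ^+ N / N`!%:R.
Proof.
have h : 0 <= (1 : R) <= 1 by rewrite ler01 lexx.
by have := @cexp_taylor_itv N 1 h; rewrite /u /v !mulr1 expr1n mulr1.
Qed.
End CexpTaylor.

(** * Integration against a countable sum of measures *)

Section Series.
Context {R : realType}.
Local Notation fmeas := {finite_measure set R -> \bar R}.

Lemma norm_Rintegral_le (mu : fmeas) (f : R -> R) K : measurable_fun setT f ->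
  (forall t, `|f t| <= K) -> `|\int[mu]_x f x|%R <= K * mass mu.
Proof.
move=> mf fK; have bf : bounded_mfun f by split => //; exists K.
have i1 := bounded_mfun_integrable (fin_num_measureT mu) bf.
apply: le_trans (le_normr_Rintegral measurableT i1) _.
rewrite -[K * _](Rintegral_cst mu measurableT K); apply: le_Rintegral => //.
  apply: bounded_mfun_integrable; first exact: fin_num_measureT.
  split; first exact: measurableT_comp.
  by exists K => t; rewrite normr_id.
apply: bounded_mfun_integrable; [exact: fin_num_measureT|exact: bounded_mfun_cst].
Qed.

Lemma finite_mseries (mu : fmeas ^nat) L :
  (forall N, \sum_(k < N) mass (mu k) <= L) ->
  exists nu : fmeas, (nu : set R -> \bar R) = mseries mu 0.
Proof.
move=> massL; apply: (@finite_measure_of R (mseries mu 0)).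
rewrite /= /mseries; apply: (@le_lt_trans _ _ L%:E); last exact: ltry.
apply: lime_le; first exact: is_cvg_ereal_nneg_natsum.
apply: nearW => N; rewrite big_mkord.
have -> : (\sum_(i < N) mu i setT = (\sum_(i < N) mass (mu i))%:E)%E.
  by rewrite -sumEFin; apply: eq_bigr => i _; rewrite /mass fineK // fin_num_measure.
by rewrite lee_fin.
Qed.

(** For nonnegative integrands the integral is countably additive in the measure; a function bounded
    by K is reduced to this case as (f + K) - K. *)
Lemma Rintegral_mseries (mu : fmeas ^nat) (nu : fmeas) (f : R -> R) :
  (nu : set R -> \bar R) = mseries mu 0 -> bounded_mfun f ->
  (\sum_(k < N) (\int[mu k]_x f x)%R) @[N --> \oo] --> (\int[nu]_x f x)%R.
Proof.
move=> nuE.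
have ge0 (g : R -> R) : bounded_mfun g -> (forall t, 0 <= g t) ->
    (\sum_(k < N) (\int[mu k]_x g x)%R) @[N --> \oo] --> (\int[nu]_x g x)%R.
  move=> bg g0.
  have int (m : fmeas) : (\int[m]_x (g x)%:E)%E = ((\int[m]_x g x)%R)%:E.
    rewrite /Rintegral fineK //; apply: integrable_fin_num => //.
    exact: (bounded_mfun_integrable (fin_num_measureT m) bg).
  have mg : measurable_fun setT (EFin \o g) by apply/measurable_EFinP; case: bg.
  have h : (\int[nu]_x (g x)%:E = \big[+%E/0]_(0 <= n <oo) (\int[mu n]_x (g x)%:E))%E.
    have -> : (\int[nu]_x (g x)%:E)%E = (\int[mseries mu 0]_x (g x)%:E)%E by rewrite -nuE.
    rewrite ge0_integral_measure_series // => t _; by rewrite lee_fin.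
  have c : (\sum_(0 <= k < N) (\int[mu k]_x (g x)%:E))%E @[N --> \oo] -->
      (\int[nu]_x (g x)%:E)%E.
    rewrite h; apply: is_cvg_ereal_nneg_natsum => n _.
    by apply: integral_ge0 => t _; rewrite lee_fin.
  move: c; rewrite int => /fine_cvgP [_]; apply: cvg_trans; apply: near_eq_cvg.
  apply: nearW => N /=; rewrite big_mkord.
  rewrite (eq_bigr (fun i : 'I_N => (\int[mu i]_x g x)%R%:E)); last by move=> i _; exact: int.
  by rewrite sumEFin.
move=> bf; have [mf [K fK]] := bf.
have b1 : bounded_mfun (fun t => f t + K) by apply: bounded_mfunD => //; exact: bounded_mfun_cst.
have b2 : bounded_mfun (fun _ : R => K) by exact: bounded_mfun_cst.
have K0 : 0 <= K by apply: le_trans (fK point); exact: normr_ge0.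
have c1 := ge0 _ b1 _; have c2 := ge0 _ b2 _.
have int (m : fmeas) : (\int[m]_x f x)%R = (\int[m]_x (f x + K))%R - (\int[m]_x K)%R.
  rewrite -RintegralB //; last 2 first.
  - exact: (bounded_mfun_integrable (fin_num_measureT m) b1).
  - exact: (bounded_mfun_integrable (fin_num_measureT m) b2).
  by apply: eq_Rintegral => t _; rewrite addrK.
rewrite int; under eq_fun do (under eq_bigr do rewrite int; rewrite sumrB).
apply: cvgB; [apply: c1|apply: c2] => t //.
by have := fK t; rewrite ler_norml => /andP[h _]; rewrite -lerBlDr sub0r.
Qed.
End Series.

(** * Summation over the orders in B *)

Section SeriesRep.
Context {R : realType}.
Local Notation fmeas := {finite_measure set R -> \bar R}.
Variables (a b : R).
Hypothesis ab : a <= b.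

Lemma sum_exp_coeff_le (x : R) N : 0 <= x -> \sum_(k < N) x ^+ k / k`!%:R <= expR x.
Proof.
move=> x0; have -> : \sum_(k < N) x ^+ k / k`!%:R = series (exp_coeff x) N.
  by rewrite /series /= big_mkord.
apply: nondecreasing_cvgn_le; last exact: is_cvg_series_exp_coeff.
apply: nondecreasing_series => n _ _; exact: exp_coeff_ge0.
Qed.

(* The binomial formula bounds the truncation error of the double series. *)
Lemma exp_conv_le (s t : R) N : 0 <= s -> 0 <= t ->
  \sum_(k < N) t ^+ (N - k) / (N - k)`!%:R * (s ^+ k / k`!%:R) <= (t + s) ^+ N / N`!%:R.
Proof.
move=> s0 t0; rewrite exprDn mulr_suml big_ord_recr /= ler_wpDr //.
  by rewrite subnn expr0 mul1r divr_ge0 // mulrn_wge0 // exprn_ge0.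
rewrite le_eqVlt; apply/orP; left; apply/eqP; apply: eq_bigr => k _.
have kN : (k <= N)%N by apply: ltnW.
rewrite -(bin_fact kN) -mulr_natr !natrM; field.
by rewrite !natr_fact_neq0 pnatr_eq0 -lt0n bin_gt0 kN.
Qed.

Lemma bounded_poly_clip (al : nat -> R) N :
  bounded_mfun (fun x : R => \sum_(m < N) al m * clip a b x ^+ m).
Proof.
elim: N => [|N IH].
  rewrite (_ : (fun _ => _) = (fun=> 0)); first exact: bounded_mfun_cst.
  by apply/funext => x; rewrite big_ord0.
rewrite (_ : (fun _ => _) = (fun x => \sum_(m < N) al m * clip a b x ^+ m)
   \+ (fun x => al N * clip a b x ^+ N)).
  apply: (bounded_mfunD IH).
  by apply: bounded_mfunM; [exact: bounded_mfun_cst|exact: bounded_pow_clip].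
by apply/funext => x; rewrite big_ord_recr.
Qed.

Lemma Rintegral_poly_clip (mu : fmeas) (al : nat -> R) N :
  (\int[mu]_x (\sum_(m < N) al m * clip a b x ^+ m))%R = \sum_(m < N) al m * moment a b mu m.
Proof.
have iT m : mu.-integrable setT (EFin \o (fun x => al m * clip a b x ^+ m)).
  apply: bounded_mfun_integrable; first exact: fin_num_measureT.
  by apply: bounded_mfunM; [exact: bounded_mfun_cst|exact: bounded_pow_clip].
elim: N => [|N IH].
  by rewrite big_ord0; under eq_Rintegral do rewrite big_ord0; rewrite Rintegral_cst // mul0r.
rewrite big_ord_recr /= -IH.
transitivity (\int[mu]_x (\sum_(m < N) al m * clip a b x ^+ m + al N * clip a b x ^+ N))%R.
  by apply: eq_Rintegral => x _; rewrite big_ord_recr.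
rewrite RintegralD //; first congr (_ + _).
  rewrite RintegralZl //; apply: bounded_mfun_integrable; first exact: fin_num_measureT.
  exact: bounded_pow_clip.
by apply: bounded_mfun_integrable; [exact: fin_num_measureT|exact: bounded_poly_clip].
Qed.

(** The measures are chosen before f. Cutting order k after N - k Taylor terms costs at most E
    t^(N-k) / (N-k)! times the mass C s^k / k!; summed over k < N this is at most C E (t + s)^N /
    N!, which tends to 0. *)
Lemma series_rep (q : nat -> nat -> R) (C s : R) : 0 <= C -> 0 <= s ->
  (forall k, moment_rep a b (C * (s ^+ k / k`!%:R)) (q k)) ->
  exists mu nu : fmeas, forall (f : R -> R) (al : nat -> R) (E t : R),
     measurable_fun setT f -> 0 <= E -> 0 <= t ->
     (forall x N, a <= x <= b -> `|f x - \sum_(m < N) al m * x ^+ m| <= E * (t ^+ N / N`!%:R)) ->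
     (\sum_(k < N) \sum_(m < N - k) al m * q k m) @[N --> \oo] -->
       (\int[mu]_(x in `[a, b]) f x)%R - (\int[nu]_(x in `[a, b]) f x)%R.
Proof.
move=> C0 s0 rep.
have /choice[mn mnE] : forall k, exists p : fmeas * fmeas,
    mass p.1 + mass p.2 <= C * (s ^+ k / k`!%:R) /\
    forall m, q k m = moment a b p.1 m - moment a b p.2 m.
  by move=> k; have [mu [nu [h1 h2]]] := rep k; exists (mu, nu).
pose mus k := (mn k).1; pose nus k := (mn k).2.
have massge0 (m : fmeas) : 0 <= mass m by exact: mass_ge0.
have sumL N : \sum_(k < N) C * (s ^+ k / k`!%:R) <= C * expR s.
  by rewrite -mulr_sumr ler_wpM2l // sum_exp_coeff_le.
have muL N : \sum_(k < N) mass (mus k) <= C * expR s.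
  apply: le_trans (sumL N); apply: ler_sum => k _; apply: le_trans (proj1 (mnE k)).
  by rewrite lerDl.
have nuL N : \sum_(k < N) mass (nus k) <= C * expR s.
  apply: le_trans (sumL N); apply: ler_sum => k _; apply: le_trans (proj1 (mnE k)).
  by rewrite lerDr.
have [mu0 mu0E] := finite_mseries muL.
have [nu0 nu0E] := finite_mseries nuL.
have mclip := @measurable_clip R a b.
(* Pushing forward by [clip] concentrates the measures on [[a, b]], so that restricting the integral
   to the interval loses nothing. *)
have [mu muE] := finite_pushforward (fin_num_measureT mu0) mclip.
have [nu nuE] := finite_pushforward (fin_num_measureT nu0) mclip.
exists mu, nu.
move=> f al E t mf E0 t0 fE.
(* The remainder bound for N = 0. *)
have fb x : a <= x <= b -> `|f x| <= E.
  by move=> xab; have := fE x 0%N xab; rewrite big_ord0 subr0 expr0 fact0 divr1 mulr1.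
have bfr : bounded_mfun (f \_ `[a, b]).
  split; first by apply/(measurable_restrictT f); [exact: measurable_itv|exact: measurable_funTS].
  exists E => x; rewrite patchE; case: ifPn => [|_]; last by rewrite normr0.
  by rewrite inE /= in_itv /= => /fb.
pose g x := f (clip a b x).
have bg : bounded_mfun g.
  split; first by apply: measurableT_comp.
  by exists E => x; apply: fb; exact: clip_itv.
have push (m m0 : fmeas) : (m : set R -> \bar R) = pushforward m0 (clip a b) ->
    (\int[m]_(x in `[a, b]) f x)%R = (\int[m0]_x g x)%R.
  move=> mE; rewrite Rintegral_mkcond (Rintegral_pushforward (fin_num_measureT m0) mclip mE bfr).
  apply: eq_Rintegral => x _; rewrite patchE mem_set //=.
  by rewrite in_itv /=; exact: clip_itv.
rewrite (push _ _ muE) (push _ _ nuE).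
have cv : (\sum_(k < N) ((\int[mus k]_x g x)%R - (\int[nus k]_x g x)%R)) @[N --> \oo] -->
    (\int[mu0]_x g x)%R - (\int[nu0]_x g x)%R.
  under eq_fun do rewrite sumrB.
  by apply: cvgB; apply: Rintegral_mseries.
have diff : (\sum_(k < N) (\sum_(m < N - k) al m * q k m -
     ((\int[mus k]_x g x)%R - (\int[nus k]_x g x)%R))) @[N --> \oo] --> (0 : R).
  have r0 : (C * E * ((t + s) ^+ N / N`!%:R)) @[N --> \oo] --> (0 : R).
    by rewrite -[X in _ --> X](mulr0 (C * E));
    apply: cvgM; [exact: cvg_cst|exact: (@cvg_exp_coeff R (t + s))].
  have nr0 : (- (C * E * ((t + s) ^+ N / N`!%:R))) @[N --> \oo] --> (0 : R).
    by rewrite -[X in _ --> X]oppr0; apply: cvgN.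
  apply: (squeeze_cvgr _ nr0 r0); apply: nearW => N; rewrite -ler_norml.
  apply: le_trans (ler_norm_sum _ _ _) _.
  apply: (@le_trans _ _ (\sum_(k < N) E * (t ^+ (N - k) / (N - k)`!%:R) *
    (C * (s ^+ k / k`!%:R)))); last first.
    apply: le_trans (ler_wpM2l (mulr_ge0 C0 E0) (exp_conv_le N s0 t0)).
    by rewrite mulr_sumr; apply: ler_sum => k _; rewrite le_eqVlt; apply/orP; left; apply/eqP; ring.
  apply: ler_sum => k _; set M := (N - k)%N.
  have one (m : fmeas) : `|(\int[m]_x g x)%R - \sum_(j < M) al j * moment a b m j|
      <= E * (t ^+ M / M`!%:R) * mass m.
    have bp : bounded_mfun (fun x => \sum_(j < M) al j * clip a b x ^+ j) by exact: bounded_poly_clip.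
    rewrite -Rintegral_poly_clip -RintegralB //; last 2 first.
    - exact: (bounded_mfun_integrable (fin_num_measureT m) bg).
    - exact: (bounded_mfun_integrable (fin_num_measureT m) bp).
    apply: norm_Rintegral_le; first by apply: measurable_funB; [case: bg|case: bp].
    by move=> x; apply: fE; exact: clip_itv.
  have -> : \sum_(m < M) al m * q k m - ((\int[mus k]_x g x)%R - (\int[nus k]_x g x)%R) =
     ((\int[nus k]_x g x)%R - \sum_(j < M) al j * moment a b (nus k) j)
     - ((\int[mus k]_x g x)%R - \sum_(j < M) al j * moment a b (mus k) j).
    rewrite (eq_bigr (fun j : 'I_M => al j * moment a b (mus k) j - al j * moment a b (nus k) j)).
      by rewrite sumrB; ring.
    by move=> j _; rewrite (proj2 (mnE k)) mulrBr.
  apply: le_trans (ler_normB _ _) _; apply: le_trans (lerD (one _) (one _)) _.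
  rewrite -mulrDr ler_wpM2l //; last by rewrite addrC; exact: (proj1 (mnE k)).
  by rewrite mulr_ge0 // divr_ge0 // exprn_ge0.
set u := (fun N => _) in diff; set w := (fun N => _) in cv.
have h : (fun N => u N + w N) @ \oo -->
    (\int[mu0]_x g x)%R - (\int[nu0]_x g x)%R.
  by rewrite -[X in _ --> X]add0r; exact: cvgD.
rewrite (_ : (fun N => _) = (fun N => u N + w N)) //; apply/funext => N.
by rewrite /u /w -big_split /=; apply: eq_bigr => k _; rewrite subrK.
Qed.
End SeriesRep.

(** * Variations of a signed measure and the integral they define *)

Section Jordan.
Context {R : realType}.
Local Notation fmeas := {finite_measure set R -> \bar R}.

Import HBNNSimple.

(** Needed because [pos_var] and [neg_var] are bare set functions, equal to measures on measurable
    sets only. Integrals of simple functions evaluate them at fibres, which are measurable. *)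
Lemma eq_integral_on_measurable d (T : measurableType d) (m1 m2 : set T -> \bar R)
    (D : set T) (f : T -> \bar R) :
  (forall A, measurable A -> m1 A = m2 A) ->
  (\int[m1]_(x in D) f x = \int[m2]_(x in D) f x)%E.
Proof.
move=> m12; rewrite /integral.
suff E (g : T -> \bar R) :
  [set sintegral m1 h | h in [set h : {nnsfun T >-> R} | forall x, ((h x)%:E <= g x)%E]] =
  [set sintegral m2 h | h in [set h : {nnsfun T >-> R} | forall x, ((h x)%:E <= g x)%E]].
  by rewrite !E.
apply: eq_imagel => h _; rewrite /sintegral; apply: eq_fsbigr => r _.
by rewrite m12 //.
Qed.

Variables (a b : R).

(* Nothing is required off [a, b]. *)
Definition difference_of (mu nu : fmeas) (rho : set R -> R) : Prop :=
  forall S, borel_in a b S -> rho S = fine (mu S) - fine (nu S).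

Section Difference.
Variables (mu nu : fmeas) (rho : set R -> R).
Hypothesis rhoE : difference_of mu nu rho.

(** For a Hahn decomposition P, N of mu - nu, the suprema over Borel subsets of E are attained at
    the traces of P and N on E and [[a, b]]; the variations are thus the Jordan parts restricted to
    the interval. The last clause is p - n = mu - nu, written without subtraction so that it
    compares measures. *)
Lemma variation_finite_measure : exists p n : fmeas,
  [/\ forall E, measurable E -> pos_var a b rho E = p E,
      forall E, measurable E -> neg_var a b rho E = n E &
      forall E, borel_in a b E -> (p E + nu E = n E + mu E)%E].
Proof.
have mab : measurable (`[a, b]%classic : set R) by exact: measurable_itv.
pose k : {charge set R -> \bar R} :=
  cadd (charge_of_finite_measure mu) (cscale (-1) (charge_of_finite_measure nu)).
have kE A : k A = (mu A - nu A)%E by rewrite /k /= /cadd /= cscaleN1.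
have [P [N PN]] := Hahn_decomposition k.
pose jp : fmeas := jordan_pos PN; pose jn : fmeas := jordan_neg PN.
have jE A : measurable A -> k A = (jp A - jn A)%E.
  by move=> mA; rewrite (jordan_decomp PN mA) /cadd /= cscaleN1.
have jpE A : measurable A -> jp A = k (A `&` P).
  move=> mA; rewrite -[LHS]/(jordan_pos PN A) jordan_posE cjordan_posE /crestr0 mem_set //.
have jnE A : measurable A -> jn A = (- k (A `&` N))%E.
  move=> mA; rewrite -[LHS]/(jordan_neg PN A) jordan_negE cjordan_negE /crestr0 mem_set //.
pose p : fmeas := mrestr jp mab; pose n : fmeas := mrestr jn mab.
have rhok S : borel_in a b S -> (rho S)%:E = k S.
  move=> bS; rewrite (rhoE bS) kE EFinB !fineK //; apply: fin_num_measure; exact: bS.1.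
have [[mP _] [mN _] PNT PN0] := PN.
exists p, n; split.
- move=> E mE; apply/eqP; rewrite eq_le; apply/andP; split.
  + apply: ge_ereal_sup => _ [S [bS SE] <-]; rewrite (rhok _ bS) (jE _ bS.1).
    rewrite leeBlDr; last by apply: fin_num_measure; exact: bS.1.
    apply: (@le_trans _ _ (jp (E `&` `[a, b]))); last by rewrite leeDl.
    apply: le_measure; rewrite ?inE; [exact: bS.1|exact: measurableI|].
    by move=> x Sx; split; [exact: SE|exact: bS.2].
  + apply: ereal_sup_ubound; exists (E `&` `[a, b] `&` P).
      split; first split; last by move=> x [[]].
        by apply: measurableI => //; exact: measurableI.
      by move=> x [[]].
    rewrite rhok; last first.
      by split; [apply: measurableI => //; exact: measurableI|move=> x [[]]].
    by rewrite -[RHS]/(jp (E `&` `[a, b])) jpE //; exact: measurableI.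
- move=> E mE; apply/eqP; rewrite eq_le; apply/andP; split.
  + apply: ge_ereal_sup => _ [S [bS SE] <-]; rewrite EFinN (rhok _ bS) (jE _ bS.1).
    rewrite oppeB; last by rewrite fin_num_adde_defr // fin_num_measure //; exact: bS.1.
    rewrite addeC leeBlDr; last by apply: fin_num_measure; exact: bS.1.
    apply: (@le_trans _ _ (jn (E `&` `[a, b]))); last by rewrite leeDl.
    apply: le_measure; rewrite ?inE; [exact: bS.1|exact: measurableI|].
    by move=> x Sx; split; [exact: SE|exact: bS.2].
  + apply: ereal_sup_ubound; exists (E `&` `[a, b] `&` N).
      split; first split; last by move=> x [[]].
        by apply: measurableI => //; exact: measurableI.
      by move=> x [[]].
    rewrite EFinN rhok; last first.
      by split; [apply: measurableI => //; exact: measurableI|move=> x [[]]].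
    by rewrite -[RHS]/(jn (E `&` `[a, b])) jnE //; exact: measurableI.
- move=> E [mE Eab].
  have -> : p E = jp E by rewrite /p /= /mrestr setIidl.
  have -> : n E = jn E by rewrite /n /= /mrestr setIidl.
  have fin (m : fmeas) : m E \is a fin_num by exact: fin_num_measure.
  have := jE _ mE; rewrite kE.
  rewrite -(fineK (fin jp)) -(fineK (fin jn)) -(fineK (fin mu)) -(fineK (fin nu)).
  rewrite -!EFinB -!EFinD => -[h]; congr (_%:E); lra.
Qed.

(** The definition integrates against the Jordan pair, while mu and nu are arbitrary: integrating f
    against both sides of p + nu = n + mu shows that the two pairs agree. *)
Lemma rintegral_difference (f : R -> R) (K : R) :
  measurable_fun setT f -> (forall x, a <= x <= b -> `|f x| <= K) ->
  rintegral a b rho f = (\int[mu]_(x in `[a, b]) f x)%R - (\int[nu]_(x in `[a, b]) f x)%R.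
Proof.
move=> mf fK; have [p [n [pE nE pn]]] := variation_finite_measure.
have mab : measurable (`[a, b]%classic : set R) by exact: measurable_itv.
rewrite /rintegral (eq_integral_on_measurable _ _ pE) (eq_integral_on_measurable _ _ nE).
have int (m : fmeas) : m.-integrable `[a, b] (EFin \o f).
  apply: measurable_bounded_integrable => //.
  - by apply: le_lt_trans (fin_num_measureT m); apply: le_measure; rewrite ?inE.
  - exact: measurable_funTS.
  - exists K; split; first exact: num_real.
    by move=> M KM x; rewrite /= in_itv /= => /fK h; exact: le_trans h (ltW KM).
have : (\int[measure_add p nu]_(x in `[a, b]) (f x)%:E =
        \int[measure_add n mu]_(x in `[a, b]) (f x)%:E)%E.
  apply: eq_measure_integral => A mA Aab.
  rewrite -[LHS]/(measure_add p nu A) -[RHS]/(measure_add n mu A).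
  by rewrite !measure_addE pn.
rewrite (integral_measure_add mab (int p) (int nu)) (integral_measure_add mab (int n) (int mu)).
have fin (m : fmeas) : (\int[m]_(x in `[a, b]) (f x)%:E)%E \is a fin_num.
  exact: integrable_fin_num (int m).
rewrite /Rintegral -(fineK (fin p)) -(fineK (fin n)) -(fineK (fin mu)) -(fineK (fin nu)).
rewrite -!EFinD => -[] h /=; lra.
Qed.
End Difference.
End Jordan.

(** * Regularity of finite Borel measures on the line *)

Section Regularity.
Context {R : realType}.
Local Notation fmeas := {finite_measure set R -> \bar R}.

Definition regular_set (mu : fmeas) (D : set R) : Prop :=
  forall e : R, 0 < e -> exists F U : set R,
    [/\ closed F, open U, F `<=` D, D `<=` U & (mu (U `\` F) < e%:E)%E].

Lemma regular_setC (mu : fmeas) D : regular_set mu D -> regular_set mu (~` D).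
Proof.
move=> rD e e0; have [F [U [cF oU FD DU UF]]] := rD e e0.
exists (~` U), (~` F); split; [exact: open_closedC|exact: closed_openC|exact: subsetC|exact: subsetC|].
by rewrite setDE setCK setIC -setDE.
Qed.

(** Half of e is spent on approximating the [D k], with geometrically decreasing errors, and half on
    keeping only finitely many of the closed sets. *)
Lemma regular_set_bigcup (mu : fmeas) (D : nat -> set R) :
  (forall k, regular_set mu (D k)) -> regular_set mu (\bigcup_k D k).
Proof.
move=> rD e e0; have e20 : 0 < e / 2 by rewrite divr_gt0.
have /choice[FU FUE] : forall k, exists FU : set R * set R,
   [/\ closed FU.1, open FU.2, FU.1 `<=` D k, D k `<=` FU.2 &
     (mu (FU.2 `\` FU.1) < (e / 2 / (2 ^ k.+1)%:R)%:E)%E].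
  move=> k; have ek : 0 < e / 2 / (2 ^ k.+1)%:R by rewrite divr_gt0 // ltr0n expn_gt0.
  by have [F [U h]] := rD k _ ek; exists (F, U).
pose F k := (FU k).1; pose U k := (FU k).2.
have cF k : closed (F k) by have [] := FUE k.
have oU k : open (U k) by have [] := FUE k.
have mF k : measurable (F k) by exact: closed_measurable.
have mU k : measurable (U k) by exact: open_measurable.
pose UU := \bigcup_k U k; pose FF := \bigcup_k F k.
have mUU : measurable UU by exact: bigcupT_measurable.
have mFF : measurable FF by exact: bigcupT_measurable.
pose G N := \big[setU/set0]_(k < N) F k.
have mG N : measurable (G N) by exact: bigsetU_measurable.
have h1 : (mu (UU `\` FF) <= (e / 2)%:E)%E.
  apply: (@le_trans _ _ (\big[+%E/0%R]_(0 <= n <oo) mu (U n `\` F n))%E).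
    apply: measure_sigma_subadditive; [by move=> n; exact: measurableD|exact: measurableD|].
    move=> x [[k _ Ukx] FFx]; exists k => //; split => // Fkx; apply: FFx; by exists k.
  apply: le_trans (epsilon_trick0 xpredT (ltW e20)); apply: lee_nneseries => //.
  by move=> n _; apply: ltW; have [] := FUE n.
(* A countable union of closed sets need not be closed; the finite unions [G N] are, and exhaust
   [FF] by continuity from above. *)
have [N h2] : exists N, (mu (FF `\` G N) < (e / 2)%:E)%E.
  have c : (mu \o (fun N => FF `\` G N)) @ \oo --> mu (\bigcap_N (FF `\` G N)).
    apply: nonincreasing_cvg_mu.
    - by rewrite (le_lt_trans _ (fin_num_measureT mu)) // le_measure ?inE //; exact: measurableD.
    - by move=> N; exact: measurableD.
    - by apply: bigcapT_measurable => N; exact: measurableD.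
    - move=> n m nm; apply/subsetPset; apply: setDS.
      by rewrite /G; apply: subset_bigsetU.
  have c0 : \bigcap_N (FF `\` G N) = set0.
    apply/seteqP; split => // x h; have [[k _ Fkx] _] := h 0%N I.
    have [_] := h k.+1 I; apply; rewrite /G big_ord_recr /=; by right.
  rewrite c0 measure0 in c; have /fine_cvgP[_ cf] := c.
  have /cvgrPdist_lt/(_ _ e20)[N _ hN] := cf.
  exists N; have := hN N (leqnn N); rewrite /= sub0r normrN ger0_norm; last exact: fine_ge0.
  by rewrite -lte_fin fineK // fin_num_measure //; exact: measurableD.
exists (G N), UU; split.
- by apply: closed_bigsetU => k _; exact: cF.
- by apply: bigcup_open => k _; exact: oU.
- move=> x; rewrite /G -bigcup_mkord => -[k _ Fkx]; exists k => //.
  by have [_ _ + _ _] := FUE k; apply.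
- move=> x [k _ Dkx]; exists k => //; by have [_ _ _ + _] := FUE k; apply.
apply: (@le_lt_trans _ _ (mu (UU `\` FF) + mu (FF `\` G N))%E).
  apply: le_trans (measureU2 _ _ _); [|exact: measurableD|exact: measurableD].
  apply: le_measure; rewrite ?inE; [exact: measurableD|by apply: measurableU; exact: measurableD|].
  by move=> x [UUx Gx]; have [FFx|FFx] := pselect (FF x); [right|left].
rewrite (_ : e%:E = (e / 2)%:E + (e / 2)%:E)%E; last by rewrite -EFinD -splitr.
by rewrite lee_ltD // ge0_fin_numE // (le_lt_trans h1) // ltry.
Qed.

Lemma natSinv_lt (e : R) : 0 < e -> exists n, n.+1%:R^-1 < e.
Proof.
move=> e0; have [N _ hN] := near_infty_natSinv_lt (PosNum e0).
by exists N; exact: (hN N (leqnn N)).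
Qed.

(** The differences of the intervals [U n] and [F n] decrease to the empty set, so their measures
    tend to 0. *)
Lemma regular_set_ocitv (mu : fmeas) (x y : R) : regular_set mu `]x, y]%classic.
Proof.
move=> e e0.
pose F n : set R := `[x + n.+1%:R^-1, y]%classic.
pose U n : set R := `]x, y + n.+1%:R^-1[%classic.
have i0 n : 0 < n.+1%:R^-1 :> R by rewrite invr_gt0.
have imono n m : (n <= m)%N -> m.+1%:R^-1 <= n.+1%:R^-1 :> R.
  by move=> nm; rewrite lef_pV2 ?posrE // ler_nat.
have mF n : measurable (F n) by exact: measurable_itv.
have mU n : measurable (U n) by exact: measurable_itv.
have c : (mu \o (fun n => U n `\` F n)) @ \oo --> mu (\bigcap_n (U n `\` F n)).
  apply: nonincreasing_cvg_mu.
  - by rewrite (le_lt_trans _ (fin_num_measureT mu)) // le_measure ?inE //; exact: measurableD.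
  - by move=> n; exact: measurableD.
  - by apply: bigcapT_measurable => n; exact: measurableD.
  - move=> n m nm; apply/subsetPset => z [+ nF]; rewrite /U /= !in_itv /= => /andP[z1 z2].
    have h := imono n m nm; split; first by rewrite z1 (lt_le_trans z2) // lerD2l.
    move=> Fz; apply: nF; move: Fz; rewrite /F /= !in_itv /= => /andP[z3 ->].
    by rewrite andbT (le_trans _ z3) // lerD2l.
have c0 : \bigcap_n (U n `\` F n) = set0.
  apply/seteqP; split => // z h.
  have [+ _] := h 0%N I; rewrite /U /= in_itv /= => /andP[xz _].
  have zy : z <= y.
    rewrite leNgt; apply/negP => yz; have zy0 : 0 < z - y by rewrite subr_gt0.
    have [n hn] := natSinv_lt zy0; have [+ _] := h n I.
    by rewrite /U /= in_itv /= -ltrBlDl => /andP[_ /(lt_trans hn)]; rewrite ltxx.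
  have zx0 : 0 < z - x by rewrite subr_gt0.
  have [n hn] := natSinv_lt zx0; have [_] := h n I; apply.
  by rewrite /F /= in_itv /= zy andbT -lerBrDl ltW.
rewrite c0 measure0 in c; have /fine_cvgP[_ cf] := c.
have /cvgrPdist_lt/(_ _ e0)[N _ hN] := cf.
exists (F N), (U N); split.
- exact: interval_closed.
- exact: interval_open.
- move=> z; rewrite /F /= !in_itv /= => /andP[h ->]; rewrite andbT.
  by rewrite (lt_le_trans _ h) // ltrDl.
- move=> z; rewrite /U /= !in_itv /= => /andP[-> h] /=.
  by rewrite (le_lt_trans h) // ltrDl.
have := hN N (leqnn N); rewrite /= sub0r normrN ger0_norm; last exact: fine_ge0.
by rewrite -lte_fin fineK // fin_num_measure //; exact: measurableD.
Qed.

(** The regular sets form a sigma-algebra containing the half-open intervals, which generate the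
    Borel sets. *)
Lemma regular_set_measurable (mu : fmeas) (D : set R) : measurable D -> regular_set mu D.
Proof.
move=> mD; apply: (@smallest_sub _ (sigma_algebra setT) (@ocitv R) (regular_set mu)); last exact: mD.
- split.
  (* The empty set, as the interval ]0, 0]. *)
  + have := @regular_set_ocitv mu 0 0; rewrite set_itv_ge //; by rewrite bnd_simp ltxx.
  + by move=> A rA; rewrite setTD; exact: regular_setC.
  + by move=> A rA; exact: regular_set_bigcup.
- by move=> _ [[x y] _ <-]; exact: regular_set_ocitv.
Qed.

(** Regularity of one dominating measure yields a single pair F, U valid for all matrix entries. *)
Lemma dominating_measure (I : finType) (mus : I -> fmeas) :
  exists m : fmeas, forall i E, (mus i E <= m E)%E.
Proof.
suff [m mE] : exists m : fmeas, forall i E, i \in index_enum I -> (mus i E <= m E)%E.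
  by exists m => i E; apply: mE; rewrite mem_index_enum.
elim: (index_enum I) => [|i s [m mE]].
  by exists (@dirac _ R 0 R).
have [r rE] := finite_measure_add m (mus i).
exists r => j E; rewrite rE measure_addE inE => /predU1P[->|js].
  by rewrite leeDr.
by rewrite (le_trans (mE j E js)) // leeDl.
Qed.
End Regularity.

(** * Set functions representing the double series *)

Section Represents.
Context {R : realType}.
Local Notation fmeas := {finite_measure set R -> \bar R}.
Local Notation C := R[i].
Local Notation Re := (@complex.Re R).
Local Notation Im := (@complex.Im R).
Variables (a b : R).
Hypothesis ab : a <= b.

(* [q k m] is the contribution of order k in B to the m-th moment of [rho];
   only an exponential bound on Taylor remainders is asked of [f]. *)
Definition represents (rho : set R -> R) (q : nat -> nat -> R) : Prop :=
  exists mu nu : fmeas, difference_of a b mu nu rho /\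
    forall (f : R -> R) (al : nat -> R) (E t : R), measurable_fun setT f -> 0 <= E -> 0 <= t ->
     (forall x N, a <= x <= b -> `|f x - \sum_(m < N) al m * x ^+ m| <= E * (t ^+ N / N`!%:R)) ->
     (\sum_(k < N) \sum_(m < N - k) al m * q k m) @[N --> \oo] -->
       (\int[mu]_(x in `[a, b]) f x)%R - (\int[nu]_(x in `[a, b]) f x)%R.

Lemma represents_exists (q : nat -> nat -> R) (K s : R) : 0 <= K -> 0 <= s ->
  (forall k, moment_rep a b (K * (s ^+ k / k`!%:R)) (q k)) -> exists rho, represents rho q.
Proof.
move=> K0 s0 rep; have [mu [nu h]] := series_rep ab K0 s0 rep.
by exists (fun S => fine (mu S) - fine (nu S)), mu, nu.
Qed.

Lemma representsN rho q : represents rho q ->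
  represents (fun S => - rho S) (fun k m => - q k m).
Proof.
move=> [mu [nu [dmn h]]]; exists nu, mu; split; first by move=> S /dmn ->; rewrite opprB.
move=> f al E t mf E0 t0 fE; rewrite -opprB.
rewrite (_ : (fun N => _) = (fun N => - \sum_(k < N) \sum_(m < N - k) al m * q k m)); last first.
  apply/funext => N; rewrite -sumrN; apply: eq_bigr => k _.
  by rewrite -sumrN; apply: eq_bigr => m _; rewrite mulrN.
by apply: cvgN; exact: h fE.
Qed.

Lemma represents0 : represents (fun=> 0) (fun _ _ => 0).
Proof.
exists (@dirac _ R 0 R), (@dirac _ R 0 R); split; first by move=> S _; rewrite subrr.
move=> f al E t mf E0 t0 fE; rewrite subrr.
rewrite (_ : (fun N => _) = (fun=> 0)); last first.
  by apply/funext => N; rewrite big1 // => k _; rewrite big1 // => m _; rewrite mulr0.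
exact: cvg_cst.
Qed.

Lemma represents_cvg rho q (f : R -> R) (al : nat -> R) (E t : R) :
  represents rho q -> measurable_fun setT f -> 0 <= E -> 0 <= t ->
  (forall x N, a <= x <= b -> `|f x - \sum_(m < N) al m * x ^+ m| <= E * (t ^+ N / N`!%:R)) ->
  (\sum_(k < N) \sum_(m < N - k) al m * q k m) @[N --> \oo] --> rintegral a b rho f.
Proof.
move=> [mu [nu [dmn h]]] mf E0 t0 fE.
rewrite (rintegral_difference dmn mf (K := E)); first exact: h fE.
by move=> x xab; have := fE x 0%N xab; rewrite big_ord0 subr0 expr0 fact0 divr1 mulr1.
Qed.

Lemma difference_of_sigma_additive mu nu rho (F : nat -> set R) :
  difference_of a b mu nu rho ->
  (forall k, borel_in a b (F k)) -> trivIset setT F ->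
  (\sum_(k < N) rho (F k)) @[N --> \oo] --> rho (\bigcup_k F k).
Proof.
move=> dmn bF tF.
have mF k : measurable (F k) by exact: (bF k).1.
have mU : measurable (\bigcup_k F k) by exact: bigcupT_measurable.
have bU : borel_in a b (\bigcup_k F k) by split => // x [k _ /(proj2 (bF k))].
have cv (m : fmeas) : (\sum_(k < N) fine (m (F k))) @[N --> \oo] --> fine (m (\bigcup_k F k)).
  have := @measure_semi_sigma_additive _ _ _ m F mF tF mU.
  rewrite -[X in _ --> X](fineK (fin_num_measure m _ mU)) => /fine_cvgP[_].
  apply: cvg_trans; apply: near_eq_cvg; apply: nearW => N /=.
  by rewrite big_mkord sum_fine // => k _; exact: fin_num_measure.
rewrite (dmn _ bU) (_ : (fun N => _) =
  (fun N => \sum_(k < N) fine (mu (F k)) - \sum_(k < N) fine (nu (F k)))); first exact: cvgB.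
by apply/funext => N; rewrite -sumrB; apply: eq_bigr => k _; rewrite dmn.
Qed.

Lemma cexp_bound (t : C) : exists E s : R, [/\ 0 <= E, 0 <= s,
  forall x N, a <= x <= b ->
   `|Re (cexp (t * x%:C%C)) - \sum_(m < N) (Re (t ^+ m) / m`!%:R) * x ^+ m| <= E * (s ^+ N / N`!%:R) &
  forall x N, a <= x <= b ->
   `|Im (cexp (t * x%:C%C)) - \sum_(m < N) (Im (t ^+ m) / m`!%:R) * x ^+ m| <= E * (s ^+ N / N`!%:R)].
Proof.
(* [r] bounds [|x|] on [[a, b]], hence [s] bounds [l1norm] of t x; then [expR s], the witness for E,
   bounds exp |Re (t x)|. *)
pose r := `|a| + `|b|; pose s := r * l1norm t.
have r0 : 0 <= r by rewrite addr_ge0.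
have s0 : 0 <= s by rewrite mulr_ge0 // l1norm_ge0.
have zle x : a <= x <= b -> l1norm (t * x%:C%C) <= s.
  move=> /norm_itv_le xr.
  rewrite /s /l1norm Re_mul Im_mul /= !mulr0 subr0 add0r !normrM -mulrDl mulrC.
  by rewrite ler_wpM2r // addr_ge0.
have powE (x : R) m : (t * x%:C%C) ^+ m = t ^+ m * (x ^+ m)%:C%C by rewrite exprMn -rmorphXn.
exists (expR s), s; split => //.
- move=> x N xab; have [h _] := cexp_taylor (t * x%:C%C) N; move: h.
  rewrite /taylor (eq_bigr (fun m : 'I_N => (Re (t ^+ m) / m`!%:R) * x ^+ m)); last first.
    by move=> m _; rewrite powE Re_mul /= mulr0 subr0 expr1n mul1r mulrAC.
  move=> h; apply: le_trans h _; rewrite -mulrA ler_pM ?expR_ge0 //.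
  + by rewrite mulr_ge0 ?exprn_ge0 ?l1norm_ge0.
  + by rewrite ler_expR (le_trans _ (zle x xab)) // /l1norm lerDl.
  + by rewrite ler_wpM2r // lerXn2r ?nnegrE ?l1norm_ge0 ?zle.
- move=> x N xab; have [_ h] := cexp_taylor (t * x%:C%C) N; move: h.
  rewrite /taylor (eq_bigr (fun m : 'I_N => (Im (t ^+ m) / m`!%:R) * x ^+ m)); last first.
    by move=> m _; rewrite powE Im_mul /= mulr0 add0r expr1n mul1r mulrAC.
  move=> h; apply: le_trans h _; rewrite -mulrA ler_pM ?expR_ge0 //.
  + by rewrite mulr_ge0 ?exprn_ge0 ?l1norm_ge0.
  + by rewrite ler_expR (le_trans _ (zle x xab)) // /l1norm lerDl.
  + by rewrite ler_wpM2r // lerXn2r ?nnegrE ?l1norm_ge0 ?zle.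
Qed.
End Represents.

(** * Diagonalization and partial sums of the matrix exponential *)

Section Matrices.
Context {R : realType}.
Local Notation C := R[i].
Local Notation Re := (@complex.Re R).
Local Notation Im := (@complex.Im R).

Lemma hermitian_mxP n (A : 'M[C]_n) : hermitian_mx A <-> (A ^t* = A)%sesqui.
Proof.
split=> [hA|hA i j]; first by apply/matrixP => i j; rewrite !mxE; apply/esym; exact: hA.
by rewrite -{1}hA !mxE.
Qed.

(** Adjunction reverses words, turning the last-letter recursion into the first-letter one. *)
Lemma hermitian_word n (A B : 'M[C]_n) k m :
  hermitian_mx A -> hermitian_mx B -> hermitian_mx (word A B k m).
Proof.
move=> /hermitian_mxP hA /hermitian_mxP hB; apply/hermitian_mxP.
have tM (X Y : 'M[C]_n) : ((X * Y) ^t* = Y ^t* * X ^t*)%sesqui.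
  by rewrite -[X * Y]/(X *m Y) trmx_mul map_mxM.
have tD (X Y : 'M[C]_n) : ((X + Y) ^t* = X ^t* + Y ^t*)%sesqui.
  by rewrite linearD /= map_mxD.
have h0 p : (word A B 0 p ^t* = word A B 0 p)%sesqui.
  elim: p => [|p IH]; first by rewrite word0E expr0 trmx1 map_mx1.
  by rewrite {1}word0S tM hA IH -word0S_l.
elim: k m => [|k IHk] m; first exact: h0.
elim: m => [|m IHm]; first by rewrite {1}wordS0 tM hB IHk -wordS0_l.
by rewrite {1}wordSS tD !tM hA hB IHm IHk -wordSS_l.
Qed.

Lemma hermitian_diagonalization n (A : 'M[C]_n) (a b : R) :
  hermitian_mx A -> is_min_eigenvalue A a -> is_max_eigenvalue A b ->
  exists (P Q : 'M[C]_n) (d : 'I_n -> R),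
    [/\ Q *m P = 1%:M, P *m Q = 1%:M, A = Q *m diag_mx (\row_l (d l)%:C%C) *m P &
        forall i, a <= d i <= b].
Proof.
move=> /hermitian_mxP hA [_ amin] [_ bmax].
have nA : A \is normalmx by apply/normalmxP; rewrite hA.
have := orthomx_spectralP nA; set P := spectralmx A; set sp := spectral_diag A => AE.
have uP : P \in unitmx by apply: unitarymx_unit; exact: spectral_unitarymx.
have ev i : eigenvalue A (sp 0 i).
  (* Eigenvectors are row vectors here; row i of P is nonzero because P is invertible. *)
  apply/eigenvalueP; exists (row i P).
    rewrite AE -row_mul !mulmxA mulmxV // mul1mx; apply/rowP => j.
    by rewrite mul_diag_mx !mxE.
  apply/eqP => r0; have : delta_mx 0 i *m P = 0 :> 'rV[C]_n by rewrite -rowE.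
  move=> /(congr1 (mulmx^~ (invmx P))); rewrite -mulmxA mulmxV // mulmx1 mul0mx.
  by move=> /matrixP/(_ 0 i); rewrite !mxE !eqxx /= => /eqP; rewrite oner_eq0.
pose d i := Re (sp 0 i).
(* Comparable elements of [R[i]] have equal imaginary parts, so the extremal bounds also make the
   eigenvalues real. *)
have spE i : sp 0 i = (d i)%:C%C /\ a <= d i <= b.
  have := amin _ (ev i); have := bmax _ (ev i); rewrite !lecE /= => /andP[/eqP i0 h1] /andP[_ h2].
  split; last by rewrite h1 h2.
  by rewrite /d; move: i0; case: (sp 0 i) => x y /= <-.
exists P, (invmx P), d; split.
- exact: mulVmx.
- exact: mulmxV.
- rewrite {1}AE; congr (_ *m diag_mx _ *m _); apply/rowP => i.
  by rewrite mxE; exact: (spE i).1.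
- by move=> i; exact: (spE i).2.
Qed.

(** In the eigenbasis the letter B becomes [P *m B *m Q], whose norm is s; conjugating back
    multiplies masses by K = [l1mx P * l1mx Q]. *)
Lemma word_rep n (A B : 'M[C]_n) (a b : R) :
  hermitian_mx A -> is_min_eigenvalue A a -> is_max_eigenvalue A b -> a <= b ->
  exists K s : R, [/\ 0 <= K, 0 <= s & forall k i j,
    cmoment_rep a b (K * (s ^+ k / k`!%:R)) (fun m => (wcoef k m)%:C%C * word A B k m i j)].
Proof.
move=> hA amin bmax ab; have [P [Q [d [QP PQ AE dab]]]] := hermitian_diagonalization hA amin bmax.
have BE : B = Q *m (P *m B *m Q) *m P by rewrite !mulmxA QP mul1mx -mulmxA QP mulmx1.
pose s := l1mx (P *m B *m Q).
have s0 : 0 <= s by exact: l1mx_ge0.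
exists (l1mx P * l1mx Q), s; split => //; first by rewrite mulr_ge0 ?l1mx_ge0.
move=> k i j.
pose D := diag_mx (\row_l (d l)%:C%C).
have K0 : 0 <= s ^+ k / k`!%:R by rewrite divr_ge0 // exprn_ge0.
have h1 i' j' : cmoment_rep a b (s ^+ k / k`!%:R)
    (fun m => ((wcoef k m)%:C%C *: word D (P *m B *m Q) k m) i' j').
  by apply: (eq_cmoment_rep _ (word_diag_rep ab _ k dab i' j')) => m; rewrite [RHS]mxE.
have h2 := cmoment_rep_mulmxl ab Q K0 h1.
have K1 : 0 <= l1mx Q * (s ^+ k / k`!%:R) by rewrite mulr_ge0 ?l1mx_ge0.
have h3 := cmoment_rep_mulmxr ab P K1 h2 i j.
rewrite -mulrA; apply: (eq_cmoment_rep _ h3) => m.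
by rewrite AE [in RHS]BE (word_conj _ _ _ _ QP PQ) -scalemxAr -scalemxAl mxE.
Qed.

Lemma sum_triangle (V : zmodType) (F : nat -> nat -> V) N :
  \sum_(p < N) \sum_(k < p.+1) F k (p - k)%N = \sum_(k < N) \sum_(m < N - k) F k m.
Proof.
elim: N => [|N IH]; first by rewrite !big_ord0.
rewrite big_ord_recr /= IH [RHS]big_ord_recr /= subSn // subnn big_ord_recr /= big_ord1 subnn addrA.
congr (_ + _); rewrite -big_split /=; apply: eq_bigr => k _.
by rewrite (subSn (ltnW (ltn_ord k))) big_ord_recr.
Qed.

(** A partial sum of the exponential runs over the triangle k + m < N, exactly the truncation used
    in [series_rep]; the weight comes from 1 / (m + k)! = (1 / m!) [wcoef k m]. *)
Lemma expm_partialE n (A B : 'M[C]_n) (t : C) N i j :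
  expm_partial (t *: A + B) N i j =
  \sum_(k < N) \sum_(m < N - k) (t ^+ m * (m`!%:R^-1)%:C%C) * ((wcoef k m)%:C%C * word A B k m i j).
Proof.
rewrite -(sum_triangle (fun k m => (t ^+ m * (m`!%:R^-1)%:C%C) * ((wcoef k m)%:C%C * word A B k m i j))).
rewrite /expm_partial summxE; apply: eq_bigr => p _.
rewrite exp_scale_add scaler_sumr summxE; apply: eq_bigr => k _.
rewrite !mxE; rewrite !mulrA; congr (_ * _).
rewrite mulrC -mulrA; congr (_ * _).
rewrite -rmorphM /wcoef /= subnK; last by rewrite -ltnS.
rewrite mulrA mulVf ?natr_fact_neq0 // mul1r.
by rewrite fmorphV rmorph_nat.
Qed.
End Matrices.

Local Open Scope complex_scope.

(** * Assembly of the matrix-valued measure *)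

Section Assembly.
Context {R : realType}.
Local Notation C := R[i].
Local Notation Re := (@complex.Re R).
Local Notation Im := (@complex.Im R).
Local Notation fmeas := {finite_measure set R -> \bar R}.
Variables (a b : R).
Hypothesis ab : a <= b.

Definition complex_mx n (re im : 'I_n -> 'I_n -> set R -> R) (S : set R) : 'M[C]_n :=
  \matrix_(i, j) (re i j S +i* im i j S)%C.

Lemma complex_mx_countably_additive n (re im : 'I_n -> 'I_n -> set R -> R) :
  (forall i j, exists mu nu, difference_of a b mu nu (re i j)) ->
  (forall i j, exists mu nu, difference_of a b mu nu (im i j)) ->
  mx_countably_additive a b (complex_mx re im).
Proof.
move=> hre him F bF tF i j; split.
- have [mu [nu h]] := hre i j.
  rewrite mxE /= (_ : (fun N => _) = (fun N => \sum_(k < N) re i j (F k))).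
    exact: difference_of_sigma_additive h bF tF.
  by apply/funext => N; apply: eq_bigr => k _; rewrite mxE.
- have [mu [nu h]] := him i j.
  rewrite mxE /= (_ : (fun N => _) = (fun N => \sum_(k < N) im i j (F k))).
    exact: difference_of_sigma_additive h bF tF.
  by apply/funext => N; apply: eq_bigr => k _; rewrite mxE.
Qed.

Lemma complex_mx_regular n (re im : 'I_n -> 'I_n -> set R -> R) :
  (forall i j, exists mu nu, difference_of a b mu nu (re i j)) ->
  (forall i j, exists mu nu, difference_of a b mu nu (im i j)) ->
  mx_regular a b (complex_mx re im).
Proof.
move=> hre him.
have /choice[mn mnE] : forall p : 'I_n * 'I_n * bool, exists mn : fmeas * fmeas,
    difference_of a b mn.1 mn.2 ((if p.2 then re else im) p.1.1 p.1.2).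
  move=> [[i j] []] /=.
    by have [mu [nu h]] := hre i j; exists (mu, nu).
  by have [mu [nu h]] := him i j; exists (mu, nu).
have [m mE] := dominating_measure
  (fun p : ('I_n * 'I_n * bool) * bool => if p.2 then (mn p.1).1 else (mn p.1).2).
move=> D [mD _] e e0; have [F [U [cF oU FD DU UF]]] := regular_set_measurable m mD e0.
exists F, U; split => // S bS SUF i j.
have mUF : measurable (U `\` F).
  by apply: measurableD; [exact: open_measurable|exact: closed_measurable].
have mS : (m S < e%:E)%E.
  by apply: le_lt_trans UF; apply: le_measure => //; rewrite inE //; exact: bS.1.
have fin (r : fmeas) : r S \is a fin_num by apply: fin_num_measure; exact: bS.1.
(* Both measures of the pair lie between 0 and [m] on S, so their difference is at most [m S] in
   absolute value. *)
have bound (c : bool) : `|(if c then re else im) i j S| < e.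
  rewrite (mnE (i, j, c) S bS); apply: (@le_lt_trans _ _ (fine (m S))); last first.
    by rewrite -lte_fin fineK.
  have le1 := mE ((i, j, c), true) S; have le2 := mE ((i, j, c), false) S.
  have : 0 <= fine ((mn (i, j, c)).1 S) by exact: fine_ge0.
  have : 0 <= fine ((mn (i, j, c)).2 S) by exact: fine_ge0.
  move: le1 le2; rewrite /= -(fineK (fin m)) -(fineK (fin _)) lee_fin => le1.
  rewrite -(fineK (fin _)) lee_fin => le2 h2 h1.
  by rewrite ler_norml; apply/andP; split; lra.
by rewrite mxE /=; split; [exact: (bound true)|exact: (bound false)].
Qed.

Lemma measurable_Re_cexp (t : C) : measurable_fun setT (fun x : R => Re (cexp (t * x%:C))).
Proof.
rewrite (_ : (fun x => _) = (fun x => expR (Re t * x) * cos (Im t * x))).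
  apply: measurable_funM; apply: measurableT_comp => //.
  exact: continuous_measurable_fun (@continuous_cos R).
by apply/funext => x; rewrite /= Re_mul Im_mul /= !mulr0 subr0 add0r.
Qed.

Lemma measurable_Im_cexp (t : C) : measurable_fun setT (fun x : R => Im (cexp (t * x%:C))).
Proof.
rewrite (_ : (fun x => _) = (fun x => expR (Re t * x) * sin (Im t * x))).
  apply: measurable_funM; apply: measurableT_comp => //.
  exact: continuous_measurable_fun (@continuous_sin R).
by apply/funext => x; rewrite /= Re_mul Im_mul /= !mulr0 subr0 add0r.
Qed.

(** Each of the four real integrals in [cintegral] is the limit of a real double sum; combined as in
    a complex product, these sums are the partial sums of the exponential. *)
Lemma expm_mx_integral n (A B : 'M[C]_n) (re im : 'I_n -> 'I_n -> set R -> R) (t : C) :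
  (forall i j, represents a b (re i j) (fun k m => Re ((wcoef k m)%:C * word A B k m i j))) ->
  (forall i j, represents a b (im i j) (fun k m => Im ((wcoef k m)%:C * word A B k m i j))) ->
  expm (t *: A + B) = mx_integral a b (complex_mx re im) (fun l => cexp (t * l%:C)).
Proof.
move=> hre him; have [E [s [E0 s0 fre fim]]] := cexp_bound a b t.
have mre := measurable_Re_cexp t; have mim := measurable_Im_cexp t.
apply/matrixP => i j; rewrite !mxE /cintegral.
have -> : (fun S => Re (complex_mx re im S i j)) = re i j.
  by apply/funext => S; rewrite mxE.
have -> : (fun S => Im (complex_mx re im S i j)) = im i j.
  by apply/funext => S; rewrite mxE.
pose alre m := Re (t ^+ m) / m`!%:R; pose alim m := Im (t ^+ m) / m`!%:R.
have c1 := represents_cvg (al := alre) (hre i j) mre E0 s0 fre.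
have c2 := represents_cvg (al := alim) (him i j) mim E0 s0 fim.
have c3 := represents_cvg (al := alim) (hre i j) mim E0 s0 fim.
have c4 := represents_cvg (al := alre) (him i j) mre E0 s0 fre.
have coefE m : t ^+ m * (m`!%:R^-1)%:C = (Re (t ^+ m) / m`!%:R +i* (Im (t ^+ m) / m`!%:R))%C.
  by case: (t ^+ m) => u v; simpc.
congr (_ +i* _)%C; apply: cvg_lim => //.
- rewrite (_ : (fun N => _) = (fun N =>
    \sum_(k < N) \sum_(m < N - k) Re (t ^+ m) / m`!%:R * Re ((wcoef k m)%:C * word A B k m i j)
    - \sum_(k < N) \sum_(m < N - k) Im (t ^+ m) / m`!%:R * Im ((wcoef k m)%:C * word A B k m i j))).
    exact: cvgB.
  apply/funext => N; rewrite expm_partialE Re_sum -sumrB; apply: eq_bigr => k _.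
  by rewrite Re_sum -sumrB; apply: eq_bigr => m _; rewrite Re_mul coefE.
- rewrite (_ : (fun N => _) = (fun N =>
    \sum_(k < N) \sum_(m < N - k) Im (t ^+ m) / m`!%:R * Re ((wcoef k m)%:C * word A B k m i j)
    + \sum_(k < N) \sum_(m < N - k) Re (t ^+ m) / m`!%:R * Im ((wcoef k m)%:C * word A B k m i j))).
    exact: cvgD.
  apply/funext => N; rewrite expm_partialE Im_sum -big_split; apply: eq_bigr => k _.
  by rewrite Im_sum -big_split; apply: eq_bigr => m _; rewrite Im_mul coefE addrC.
Qed.

(* Choosing the measures of one triangle and copying them to the other one makes
   the matrix measure Hermitian on the nose, without a uniqueness argument. *)
Lemma symmetric_representation n (q : 'I_n -> 'I_n -> nat -> nat -> R) :
  (forall i j, exists rho, represents a b rho (q i j)) ->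
  exists rho : 'I_n -> 'I_n -> set R -> R,
    (forall i j, represents a b (rho i j) (q i j)) /\
    ((forall i j, q j i = q i j) -> forall i j, rho j i = rho i j).
Proof.
move=> h; have /choice[rho rhoE] : forall p : 'I_n * 'I_n, exists r, represents a b r (q p.1 p.2).
  by move=> p; exact: h.
have [qs|nqs] := pselect (forall i j, q j i = q i j); last first.
  by exists (fun i j => rho (i, j)); split => // i j; exact: (rhoE (i, j)).
exists (fun i j : 'I_n => if (i <= j)%N then rho (i, j) else rho (j, i)); split => [i j|_ i j].
  by case: ifP => _; [exact: (rhoE (i, j))|rewrite -qs; exact: (rhoE (j, i))].
by have [ij|ij|/val_inj ->] := ltngtP i j.
Qed.

(** Imaginary parts change sign across the diagonal, which forces the zero set function on it. *)
Lemma antisymmetric_representation n (q : 'I_n -> 'I_n -> nat -> nat -> R) :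
  (forall i j, exists rho, represents a b rho (q i j)) ->
  exists rho : 'I_n -> 'I_n -> set R -> R,
    (forall i j, represents a b (rho i j) (q i j)) /\
    ((forall i j k m, q j i k m = - q i j k m) -> forall i j S, rho j i S = - rho i j S).
Proof.
move=> h; have /choice[rho rhoE] : forall p : 'I_n * 'I_n, exists r, represents a b r (q p.1 p.2).
  by move=> p; exact: h.
have [qs|nqs] := pselect (forall i j k m, q j i k m = - q i j k m); last first.
  by exists (fun i j => rho (i, j)); split => // i j; exact: (rhoE (i, j)).
exists (fun i j : 'I_n => if (i < j)%N then rho (i, j) else
  if (j < i)%N then (fun S => - rho (j, i) S) else (fun=> 0)); split => [i j|_ i j S].
  have [ij|ij|/val_inj ij] := ltngtP i j; first exact: (rhoE (i, j)).
    rewrite (_ : q i j = (fun k m => - q j i k m)); first exact: representsN (rhoE (j, i)).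
    by apply/funext => k; apply/funext => m; rewrite qs.
  rewrite (_ : q i j = (fun _ _ => 0)); first exact: represents0.
  apply/funext => k; apply/funext => m; have := qs i j k m; rewrite -ij => h1.
  lra.
by have [ij|ij|_] := ltngtP i j; rewrite ?opprK ?oppr0.
Qed.
End Assembly.

Theorem theorem7p1 (R : realType) (n : nat) (A B : 'M[R[i]]_n)
    (lmin lmax : R) :
  hermitian_mx A -> is_min_eigenvalue A lmin -> is_max_eigenvalue A lmax ->
  exists M : set R -> 'M[R[i]]_n,
    [/\ mx_countably_additive lmin lmax M,
        mx_regular lmin lmax M,
        forall t : R[i],
          expm (t *: A + B) = mx_integral lmin lmax M (fun l => cexp (t * l%:C))
      & hermitian_mx B -> forall D, borel_in lmin lmax D -> hermitian_mx (M D)].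
Proof.
move=> hA amin bmax.
(* [lmin] is itself an eigenvalue, hence below the largest one. *)
have ab : lmin <= lmax by have := bmax.2 _ amin.1; rewrite lecR.
have [K [s [K0 s0 rep]]] := word_rep B hA amin bmax ab.
pose q i j k m := (wcoef k m)%:C * word A B k m i j.
pose qre i j k m := complex.Re (q i j k m).
pose qim i j k m := complex.Im (q i j k m).
have [re [reE reS]] := @symmetric_representation R lmin lmax n qre (fun i j =>
  represents_exists ab K0 s0 (fun k => (rep k i j).1)).
have [im [imE imS]] := @antisymmetric_representation R lmin lmax n qim (fun i j =>
  represents_exists ab K0 s0 (fun k => (rep k i j).2)).
have dre i j : exists mu nu, difference_of lmin lmax mu nu (re i j).
  by have [mu [nu [h _]]] := reE i j; exists mu, nu.
have dim i j : exists mu nu, difference_of lmin lmax mu nu (im i j).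
  by have [mu [nu [h _]]] := imE i j; exists mu, nu.
exists (complex_mx re im); split.
- exact: complex_mx_countably_additive.
- exact: complex_mx_regular.
- by move=> t; exact: expm_mx_integral.
move=> hB D _ i j; rewrite !mxE.
(* The weights are real and words in Hermitian letters sum to a Hermitian matrix. *)
have qE i' j' k m : q j' i' k m = conjc (q i' j' k m).
  rewrite /q (hermitian_word k m hA hB i' j'); move: (word A B k m i' j') => [u v].
  by simpc.
have qreE i' j' : qre j' i' = qre i' j'.
  by apply/funext => k; apply/funext => m; rewrite /qre qE; case: (q i' j' k m).
have qimE i' j' k m : qim j' i' k m = - qim i' j' k m.
  by rewrite /qim qE; case: (q i' j' k m).
by rewrite (reS qreE) (imS qimE).
Qed.
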